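(* Let $\mu$ be a shift-invariant probability measure on $A^{\mathbb{Z}}$ compatible with a probability kernel $g$ such that $\Gamma(g)>0$. Then, for all $f\in\mathcal{L}$ and all $\theta\in\mathbb{R}$, $$\mathbb{E}_{\mu}\left[e^{\theta(f-\mathbb{E}_{\mu}[f])}\right]\le \exp\left(\frac{\theta^2\,\Gamma(g)^{-2}}{8}\,\|\underline{\delta}(f)\|_2^2\right),$$ and, for all $u>0$, $$\mu\left(\left|f-\mathbb{E}_{\mu}[f]\right|>u\right)\le 2\exp\left(-\frac{2u^2}{\Gamma(g)^{-2}\,\|\underline{\delta}(f)\|_2^2}\right).$$
   Context: $A$ is a countable set with the discrete topology; $A^{\mathbb{Z}}$ has the product topology and the $\sigma$-algebra generated by cylinders; the shift is $(T\omega)_i=\omega_{i+1}$, and $\mu$ is shift-invariant if $\mu\circ T^{-1}=\mu$. For integers $i\le j$, $\omega_i^j=(\omega_i,\dots,\omega_j)$ (the empty string if $i>j$). $\mathcal{X}^-=A^{\{\dots,-2,-1\}}$. A probability kernel is a function $g:A\times\mathcal{X}^-\to[0,1]$ with $\sum_{s\in A}g(s|x)=1$ for all $x\in\mathcal{X}^-$; for a left-infinite sequence ending at another index $n-1$, $g(\cdot|\cdot)$ denotes the same function after re-indexing (kernels are shift-invariant). A probability measure $\mu$ on $A^{\mathbb{Z}}$ is compatible with $g$ if for all $n\in\mathbb{Z}$, $a\in A$, and $\mu$-a.e. past $x=(\dots,x_{n-2},x_{n-1})$, the conditional probability under $\mu$ that the $n$-th coordinate equals $a$ given the $\sigma$-algebra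 $\mathcal{F}_{-\infty}^{n-1}$ generated by coordinates up to $n-1$ is $g(a|x)$. For $j\ge1$, $\mathrm{Var}_j(g)=\sup\{\frac12\sum_{a\in A}|g(a|z)-g(a|z')|: z,z'\in\mathcal{X}^-,\ z_k=z'_k\ \forall k\ge -j\}$; $\mathrm{Var}_0(g)=\sup_{z,z'\in\mathcal{X}^-}\frac12\sum_{a\in A}|g(a|z)-g(a|z')|$; and $\Gamma(g)=\prod_{j=0}^\infty(1-\mathrm{Var}_j(g))$. For $f:A^{n+1}\to\mathbb{R}$ and $0\le j\le n$, $\delta_j(f)=\sup\{|f(\omega_0^{j-1}a\,\omega_{j+1}^n)-f(\omega_0^{j-1}b\,\omega_{j+1}^n)|: a,b\in A,\ \omega\in A^{n+1}\}$. $\mathcal{L}=\bigcup_{n\ge0}\mathcal{L}_n$ with $\mathcal{L}_n=\{f:A^{n+1}\to\mathbb{R}: \delta_j(f)<\infty,\ j=0,\dots,n\}$; such $f$ is viewed as a function of the coordinates $0,\dots,n$. $\|\underline{\delta}(f)\|_2^2=\sum_{j=0}^n\delta_j(f)^2$ for $f\in\mathcal{L}_n$. *)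

(* Defs.v *)
From HB Require Import structures.
From mathcomp Require Import all_boot all_order all_algebra.
From mathcomp Require Import all_classical all_reals all_analysis.

Set Implicit Arguments.
Unset Strict Implicit.
Unset Printing Implicit Defensive.

Import Order.TTheory GRing.Theory Num.Theory.
Import numFieldNormedType.Exports.

Local Open Scope classical_set_scope.
Local Open Scope ring_scope.

(* [cylinders A] contains all the sets {w | w_i^j = a_i^j}; for i > j this is
   the whole space. *)
Definition cylinders (A : pointedType) : set (set (int -> A)) :=
  [set C | exists (i j : int) (a : int -> A),
     C = [set w | forall k : int, i <= k <= j -> w k = a k]].

Definition paths (A : pointedType) := g_sigma_algebraType (@cylinders A).

Definition left_shift (A : pointedType) (w : paths A) : paths A :=
  fun i => w (i + 1).

Definition shift_invariant (R : realType) (A : pointedType)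
    (mu : probability (paths A) R) : Prop :=
  forall B : set (paths A), measurable B ->
    mu (@left_shift A @^-1` B) = mu B.

(* A left-infinite past (..., x_{-2}, x_{-1}) is encoded as a function on nat:
   the value at k is the coordinate of index -(k + 1). *)
Definition pasts (A : Type) := nat -> A.

(* The past (..., w_{n-2}, w_{n-1}), re-indexed so as to end at index -1. *)
Definition past (A : pointedType) (n : int) (w : paths A) : pasts A :=
  fun k => w (n - k.+1%:Z).

(* [g s x] stands for g(s|x). *)
Definition is_prob_kernel (R : realType) (A : pointedType)
    (g : A -> pasts A -> R) : Prop :=
  (forall s x, 0 <= g s x <= 1) /\
  (forall x, (\esum_(s in [set: A]) (g s x)%:E = 1)%E).

(* Generators of the sigma-algebra F_{-oo}^{n-1} of the coordinates < n. *)
Definition past_events (A : pointedType) (n : int) : set (set (paths A)) :=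
  [set C | exists (k : int) (S : set A), k < n /\ C = [set w | S (w k)]].

(* [h] is a version of the conditional probability of the event [B] given the
   sigma-algebra generated by [G]. *)
Definition is_cond_prob (R : realType) (A : pointedType)
    (mu : probability (paths A) R) (G : set (set (paths A)))
    (B : set (paths A)) (h : paths A -> R) : Prop :=
  [/\ measurable_fun [set: g_sigma_algebraType G]
        (h : g_sigma_algebraType G -> R),
      mu.-integrable [set: paths A] (EFin \o h)
    & forall C, <<s G >> C ->
        (\int[mu]_(w in C) (h w)%:E = mu (C `&` B))%E].

(* A kernel is not assumed measurable: compatibility says that some version of
   the conditional probability agrees with it almost everywhere. *)
Definition compatible (R : realType) (A : pointedType)
    (mu : probability (paths A) R) (g : A -> pasts A -> R) : Prop :=
  forall (n : int) (a : A), exists h : paths A -> R,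
    is_cond_prob mu (@past_events A n) [set w | w n = a] h /\
    {ae mu, forall w, h w = g a (past n w)}.

(* The constraint z_i = z'_i for i >= -j is on the first j entries of the
   encodings; it is void for j = 0. *)
Definition Var (R : realType) (A : pointedType) (g : A -> pasts A -> R)
    (j : nat) : \bar R :=
  ereal_sup [set v | exists z z' : pasts A,
    (forall k : nat, (k < j)%N -> z k = z' k) /\
    (v = 2^-1%:E * \esum_(a in [set: A]) `|g a z - g a z'|%:E)%E].

(* For a probability kernel, the [Var g j] lie in [0, 1], so that [fine] is
   harmless and the partial products converge. *)
Definition Gamma (R : realType) (A : pointedType) (g : A -> pasts A -> R) : R :=
  limn (fun n : nat => \prod_(0 <= j < n) (1 - fine (Var g j))).

Definition osc (R : realType) (A : pointedType) (n : nat)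
    (f : ('I_n.+1 -> A) -> R) (j : 'I_n.+1) : \bar R :=
  ereal_sup [set v | exists (a b : A) (w : 'I_n.+1 -> A),
    v = (`|f [eta w with j |-> a] - f [eta w with j |-> b]|)%:E].

Definition finite_osc (R : realType) (A : pointedType) (n : nat)
    (f : ('I_n.+1 -> A) -> R) : Prop :=
  forall j : 'I_n.+1, (osc f j < +oo)%E.

Definition osc_norm2 (R : realType) (A : pointedType) (n : nat)
    (f : ('I_n.+1 -> A) -> R) : R :=
  \sum_(j < n.+1) fine (osc f j) ^+ 2.

Definition on_paths (R : realType) (A : pointedType) (n : nat)
    (f : ('I_n.+1 -> A) -> R) : paths A -> R :=
  fun w => f (fun i : 'I_n.+1 => w i%:Z).

(* Main.v *)
(* Let P be the transfer operator (P h)(x) = sum_s g(s|x) h(s x), so that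
   E_mu[h(x_n, x_{n-1}, ...)] = E_mu[(P h)(x_{n-1}, ...)] by compatibility.
   Write f as a function h_0 of the past of n + 1 and put h_{m+1} = P h_m.
   Hoeffding's lemma under g(.|x) gives
     P(exp(theta h_m)) <= exp(theta h_{m+1} + theta^2 c_m^2 / 8)
   where c_m bounds the oscillation of h_m in its last coordinate; iterating,
   E[exp(theta f)] <= exp(theta^2 / 8 * sum_m c_m^2) E[exp(theta h_M)].
   Under a maximal coupling, two copies of the chain whose pasts agree on their
   last l coordinates stop agreeing at the next step with probability at most
   Var_l(g).  Hence c_m = e_m + sum_r q_r c_{m-r} with e_m the oscillations of f
   and q the law of the return time to 0 of the "house of cards" chain, of total
   mass at most 1 - Gamma(g).  Jensen's inequality then yields
   sum_m c_m^2 <= Gamma(g)^-2 ||delta(f)||^2.  In particular c_M tends to 0, so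
   that h_M is uniformly close to E[f].
   Gamma(g) > 0 also forces Var_l(g) -> 0: the kernel is uniformly continuous in
   the past, hence measurable, and so are all the functions above. *)
Require Import Defs.
From mathcomp Require Import all_boot all_order all_algebra.
From mathcomp Require Import all_classical all_reals all_analysis.
From mathcomp Require Import measurable_realfun.
From mathcomp Require Import ring lra.
Set Implicit Arguments.
Unset Strict Implicit.
Unset Printing Implicit Defensive.

Import Order.TTheory GRing.Theory Num.Theory.
Import numFieldNormedType.Exports.
Local Open Scope classical_set_scope.
Local Open Scope ring_scope.

(** * Hoeffding's inequality for two points *)

Section hoeffding_function.
Context {R : realType} (p : R).
Hypothesis p01 : 0 <= p <= 1.

Let den (h : R) : R := 1 - p + p * expR h.

Let den_gt0 h : 0 < den h.
Proof.
have := expR_gt0 h; rewrite /den; case/andP: p01 => p0 p1 e0.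
have [->|pn0] := eqVneq p 0; first by rewrite mul0r subr0 addr0.
have : 0 < p * expR h by rewrite mulr_gt0 // lt_neqAle eq_sym pn0.
by move=> ?; lra.
Qed.

Let den_neq0 h : den h != 0. Proof. exact: lt0r_neq0. Qed.

Let q h := p * expR h / den h.

Let is_derive_den (h : R) : is_derive h 1 den (p * expR h).
Proof. by apply: is_derive_eq; rewrite /GRing.scale /=; ring. Qed.

(** The exponent of the bound minus the log moment generating function of a Bernoulli variable of
    parameter [p]; [q h] is the success probability of the law tilted by [expR h]. *)
Let gap h := p * h + h ^+ 2 / 8 - ln (den h).

Let is_derive_gap (h : R) : is_derive h 1 gap (p + h / 4 - q h).
Proof.
have dl : is_derive h 1 (@ln R \o den) ((den h)^-1 * (p * expR h)).
  exact: (@is_derive1_comp _ (@ln R) den _ _ _ (is_derive1_ln (den_gt0 h))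
    (is_derive_den h)).
rewrite (_ : gap = (fun h => p * h + h ^+ 2 / 8) - (@ln R \o den))//.
apply: is_derive_eq; rewrite /GRing.scale /= /q.
by have := den_neq0 h; rewrite /den => ?; field.
Qed.

Let slope h := p + h / 4 - q h.

Let is_derive_slope (h : R) : is_derive h 1 slope (4^-1 - q h * (1 - q h)).
Proof.
apply: is_derive_eq; rewrite /GRing.scale /= /q.
by have := den_neq0 h; rewrite /den => ?; field.
Qed.

(** [gap] and its derivative [slope] vanish at 0, and [slope] has derivative 1/4 minus the variance
    [q h * (1 - q h)] of the tilted law, which is a square. Hence both are nonnegative on the
    half-line. *)
Lemma hoeffding_pos h : 0 <= h ->
  1 - p + p * expR h <= expR (p * h + h ^+ 2 / 8).
Proof.
move=> h0.
have dcont (f df : R -> R) : (forall x : R, is_derive x (1 : R) f (df x)) ->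
    {within `[0, +oo[, continuous f}.
  move=> fdf; apply: continuous_subspaceT => x.
  by apply: differentiable_continuous; apply/derivable1_diffP; case: (fdf x).
have slope_ge0 x : 0 <= x -> 0 <= slope x.
  move=> x0; have -> : 0 = slope 0.
    by rewrite /slope /q /den expR0; field; rewrite subrK oner_neq0.
  apply: (@ger0_derive1_ndecry _ slope 0 _ _ _ 0 x (lexx 0) x0).
  - by move=> y _; exact: (@ex_derive _ _ _ _ _ _ _ (is_derive_slope y)).
  - move=> y _; rewrite derive1E; case: (is_derive_slope y) => _ ->.
    move: (q y) => t; have -> : 4^-1 - t * (1 - t) = (t - 2^-1) ^+ 2 by field.
    exact: sqr_ge0.
  - exact: dcont is_derive_slope.
have gap_ge0 : 0 <= gap h.
  have -> : 0 = gap 0 by rewrite /gap /den expR0 mulr1 subrK ln1; ring.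
  apply: (@ger0_derive1_ndecry _ gap 0 _ _ _ 0 h (lexx 0) h0).
  - by move=> y _; exact: (@ex_derive _ _ _ _ _ _ _ (is_derive_gap y)).
  - move=> y; rewrite in_itv /= andbT => /ltW y0.
    by rewrite derive1E; case: (is_derive_gap y) => _ ->; exact: slope_ge0.
  - exact: dcont is_derive_gap.
have -> : 1 - p + p * expR h = expR (ln (den h)) by rewrite lnK // posrE.
by rewrite ler_expR -subr_ge0.
Qed.

End hoeffding_function.

(** For negative [h] the two points are exchanged: [p] becomes [1 - p], [h] becomes [- h], and a
    factor [expR h] comes out. *)
Lemma hoeffding_two_points (R : realType) (p h : R) : 0 <= p <= 1 ->
  1 - p + p * expR h <= expR (p * h + h ^+ 2 / 8).
Proof.
move=> p01; have [|h0] := leP 0 h; first exact: hoeffding_pos.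
have q01 : 0 <= 1 - p <= 1 by move: p01; lra.
have := @hoeffding_pos R _ q01 (- h); rewrite oppr_ge0 => /(_ (ltW h0)) H.
have -> : 1 - p + p * expR h = (1 - (1 - p) + (1 - p) * expR (- h)) * expR h.
  by rewrite mulrDl -mulrA -expRD addNr expR0; ring.
have -> : p * h + h ^+ 2 / 8 = (1 - p) * - h + (- h) ^+ 2 / 8 + h by field.
by rewrite [leRHS]expRD ler_wpM2r ?expR_ge0.
Qed.

(** Otherwise all terms from [N] on are at least [e] and the partial sums outgrow [C]. This serves
    both for [Var g l] and for the oscillations [c_m]. *)
Lemma exists_small_term (R : realType) (u : nat -> R) (C : R) (N : nat) :
  (forall n, 0 <= u n) -> (forall n, \sum_(0 <= i < n) u i <= C) ->
  forall e, 0 < e -> exists2 n, (N <= n)%N & u n <= e.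
Proof.
move=> u0 uC e e0; apply: contrapT => no.
have ue n : (N <= n)%N -> e <= u n.
  move=> Nn; rewrite leNgt; apply/negP => une; apply: no.
  by exists n => //; exact: ltW.
have ge k : k%:R * e <= \sum_(0 <= i < N + k) u i.
  elim: k => [|k IH]; first by rewrite mul0r addn0 sumr_ge0.
  rewrite addnS big_nat_recr//= -natr1 mulrDl mul1r lerD//.
  by apply: ue; exact: leq_addr.
have := le_trans (ge (Num.truncn (C / e)).+1) (uC _).
by rewrite -ler_pdivlMr// leNgt truncnS_gt.
Qed.

(** * The house of cards chain *)

Section house_of_cards.
Context {R : realType} (V e : nat -> R).

(* [spread m l] bounds the oscillation of [h_m] between pasts that agree on their
   last [l] coordinates, where [V l] bounds the probability of a disagreement at
   the next step; [total_osc] is [c_m], and [return_weight 0 r] is the probability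
   that the chain first returns to [0] at time [r + 1]. *)
Fixpoint spread (m l : nat) : R :=
  if m is m'.+1 then
    (1 - V l) * spread m' l.+1 + V l * (e m' + spread m' 0)
  else 0.

Definition total_osc (m : nat) : R := e m + spread m 0.

Definition return_weight (l r : nat) : R :=
  (\prod_(0 <= i < r) (1 - V (l + i)%N)) * V (l + r)%N.

(** Renewal equation: the chain started at [l] first falls to 0 at some time [r.+1], and then costs
    [total_osc] with the remaining [m - r.+1] steps. *)
Lemma spread_sum m l :
  spread m l = \sum_(0 <= r < m) return_weight l r * total_osc (m - r.+1).
Proof.
elim: m l => [|m IH] l; first by rewrite big_nil.
rewrite big_nat_recl//= IH mulr_sumr addrC.
rewrite /return_weight big_nil mul1r addn0 subn1; congr (_ + _).
apply: eq_bigr => r _; rewrite subSS big_nat_recl// addn0 !mulrA.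
by rewrite addnS addSn; do 3 congr (_ * _); apply: eq_bigr => i _; rewrite addnS.
Qed.

(** Telescoping: falling before time [m] is the complement of [m] successive climbs. *)
Lemma sum_return_weight l m :
  \sum_(0 <= r < m) return_weight l r = 1 - \prod_(0 <= i < m) (1 - V (l + i)%N).
Proof.
elim: m => [|m IH]; first by rewrite !big_nil subrr.
by rewrite !big_nat_recr//= IH /return_weight; ring.
Qed.

Hypothesis V01 : forall l, 0 <= V l <= 1.
Hypothesis e0 : forall m, 0 <= e m.

Lemma return_weight_ge0 l r : 0 <= return_weight l r.
Proof.
rewrite mulr_ge0//; last by case/andP: (V01 (l + r)).
by rewrite prodr_ge0// => i _; case/andP: (V01 (l + i)); lra.
Qed.

Lemma spread_ge0 m l : 0 <= spread m l.
Proof.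
elim: m l => //= m IH l; have /andP[V0 V1] := V01 l.
by rewrite addr_ge0// mulr_ge0// ?subr_ge0// addr_ge0.
Qed.

Lemma total_osc_ge0 m : 0 <= total_osc m.
Proof. by rewrite addr_ge0 ?spread_ge0. Qed.

Lemma spread_le0 (V_noninc : forall l, V l.+1 <= V l) m l :
  spread m l <= spread m 0.
Proof.
(* The two claims feed each other: the first compares the surviving branches, the second makes
   [e k + spread k 0] the larger of the two averaged values, so that lowering the weight [V] lowers
   the average. *)
have main k : (forall l, spread k l.+1 <= spread k l) /\
    (forall l, spread k l <= spread k 0).
  elim: k => [|k [IH1 IH2]] /=; first by [].
  have step l' : (1 - V l'.+1) * spread k l'.+2 + V l'.+1 * (e k + spread k 0) <=
     (1 - V l') * spread k l'.+1 + V l' * (e k + spread k 0).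
    have := V_noninc l'; have := IH1 l'.+1; have := IH2 l'.+1; have := e0 k.
    have /andP[] := V01 l'; have /andP[] := V01 l'.+1.
    move: (V l') (V l'.+1) (spread k l'.+2) (spread k l'.+1) (spread k 0) (e k).
    by move=> v v' a b c d ? ? ? ? ? ? ? ?; nra.
  split=> //; elim=> // l' IHl'; apply: le_trans IHl'; exact: step.
exact: (main m).2.
Qed.

Variable gamma : R.
Hypothesis gamma_gt0 : 0 < gamma.
Hypothesis gamma_le : forall m, gamma <= \prod_(0 <= i < m) (1 - V i).

Let q := return_weight 0.

Let sum_q_le m : \sum_(0 <= r < m) q r <= 1 - gamma.
Proof. by rewrite sum_return_weight lerD2l lerN2; exact: gamma_le. Qed.

(** Exchange of summations: [a k] collects the weights [q r] with [k + r + 1 < M]. *)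
Let sum_conv (a : nat -> R) M :
  \sum_(0 <= m < M) \sum_(0 <= r < m) q r * a (m - r.+1)%N =
  \sum_(0 <= k < M) a k * \sum_(0 <= r < M - k.+1) q r.
Proof.
elim: M => [|M IH]; first by rewrite !big_nil.
rewrite [LHS]big_nat_recr//= IH [RHS]big_nat_recr//= subnn big_nil mulr0 addr0.
rewrite [X in _ + X]big_nat_rev/= add0n -big_split/=.
apply: eq_big_nat => k /andP[_ kM].
rewrite subnSK// subKn 1?ltnW// subSS -(subnSK kM).
by rewrite big_nat_recr//= mulrDr [q _ * _]mulrC.
Qed.

(** Jensen's inequality for the square: [total_osc m] is the combination of [e m / gamma] with
    weight [gamma] and of the earlier values with weights [q r], of total mass at most 1. It comes
    from expanding the weighted sum of squared deviations from [S]. *)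
Let total_osc_sqr m : total_osc m ^+ 2 <=
  gamma^-1 * e m ^+ 2 + \sum_(0 <= r < m) q r * total_osc (m - r.+1) ^+ 2.
Proof.
set S := total_osc m.
have SE : S = e m + \sum_(0 <= r < m) q r * total_osc (m - r.+1).
  by rewrite /S /total_osc spread_sum.
have : 0 <= gamma * (e m / gamma - S) ^+ 2 +
    \sum_(0 <= r < m) q r * (total_osc (m - r.+1) - S) ^+ 2.
  apply: addr_ge0; first by rewrite mulr_ge0 ?sqr_ge0 ?ltW.
  apply: sumr_ge0 => r _.
  by rewrite mulr_ge0 ?sqr_ge0 ?return_weight_ge0.
have -> : \sum_(0 <= r < m) q r * (total_osc (m - r.+1) - S) ^+ 2 =
    \sum_(0 <= r < m) q r * total_osc (m - r.+1) ^+ 2 -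
    S *+ 2 * (\sum_(0 <= r < m) q r * total_osc (m - r.+1)) +
    S ^+ 2 * \sum_(0 <= r < m) q r.
  rewrite !mulr_sumr -sumrB -big_split/=; apply: eq_bigr => r _; ring.
have := sum_q_le m.
have -> : \sum_(0 <= r < m) q r * total_osc (m - r.+1) = S - e m by rewrite SE; ring.
have -> : gamma * (e m / gamma - S) ^+ 2 =
    gamma^-1 * e m ^+ 2 - S * e m *+ 2 + gamma * S ^+ 2.
  by field; exact: lt0r_neq0.
move: (\sum_(0 <= r < m) q r * _ ^+ 2) (\sum_(0 <= r < m) q r) => T Q.
move=> QG H; have : 0 <= S ^+ 2 * (1 - gamma - Q).
  by rewrite mulr_ge0 ?sqr_ge0// subr_ge0.
by move: (gamma^-1) H => gi H; lra.
Qed.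

(** Summing the previous bound over [m] gives [C <= gamma^-1 * E + (1 - gamma) * C]; absorbing the
    last term brings the second factor [gamma^-1]. *)
Lemma sum_total_osc_sqr M :
  \sum_(0 <= m < M) total_osc m ^+ 2 <= gamma ^- 2 * \sum_(0 <= m < M) e m ^+ 2.
Proof.
set C := \sum_(0 <= m < M) _; set E := \sum_(0 <= m < M) _.
have : C <= gamma^-1 * E + (1 - gamma) * C.
  apply: (@le_trans _ _ (gamma^-1 * E + \sum_(0 <= m < M)
      \sum_(0 <= r < m) q r * total_osc (m - r.+1) ^+ 2)).
    by rewrite mulr_sumr -big_split/=; apply: ler_sum.
  rewrite lerD2l (sum_conv (fun k => total_osc k ^+ 2)) mulr_sumr.
  by apply: ler_sum => k _; rewrite mulrC ler_wpM2r ?sqr_ge0.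
rewrite mulrBl mul1r => H.
have {}H : gamma * C <= gamma^-1 * E by lra.
by rewrite -exprVn expr2 -mulrA ler_pdivlMl.
Qed.

End house_of_cards.

(** * Averages over a countable alphabet *)

Section countable_sum.
Local Open Scope ereal_scope.
Context {R : realType} {T : pointedType}.
Hypothesis cT : countable [set: T].

(** A single enumeration serves all [F], so that facts on series transfer to sums over the alphabet:
    [d] inverts an injection into [nat], and [P] is its range. *)
Lemma esum_eseries : exists P : pred nat, exists d : nat -> T,
  forall F : T -> \bar R, (forall t, 0 <= F t) ->
    \esum_(t in [set: T]) F t = \sum_(i <oo | P i) F (d i).
Proof.
case/countable_injP: cT => c c_inj.
pose d i := xget point [set t | c t = i].
have cK t : d (c t) = t.
  rewrite /d; case: xgetP => [t' _ /= ctt'|/(_ t) []//].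
  by apply: c_inj => //; rewrite inE.
exists (fun i => i \in range c); exists d => F F0.
rewrite nneseries_esum// [in RHS](_ : [set x | _] = range c); last first.
  by apply/seteqP; split=> i /=; rewrite inE.
rewrite esum_image; first by apply: eq_esum => t _; rewrite cK.
by move=> s t; exact: c_inj.
Qed.

Lemma ge0_esumZl (k : R) (F : T -> \bar R) : (0 <= k)%R -> (forall t, 0 <= F t) ->
  \esum_(t in [set: T]) (k%:E * F t) = k%:E * \esum_(t in [set: T]) F t.
Proof.
move=> k0 F0; have [P [d E]] := esum_eseries.
by rewrite !E//; [rewrite nneseriesZl | move=> t; rewrite mule_ge0].
Qed.

Lemma ge0_integral_esum (dT : measure_display) (S : measurableType dT)
    (mu : {measure set S -> \bar R}) (F : T -> S -> \bar R) :
  (forall t, measurable_fun [set: S] (F t)) -> (forall t w, 0 <= F t w) ->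
  \int[mu]_w (\esum_(t in [set: T]) F t w) = \esum_(t in [set: T]) \int[mu]_w F t w.
Proof.
move=> mF F0; have [P [d E]] := esum_eseries.
rewrite E; last by move=> t; exact: integral_ge0.
under eq_integral do rewrite E// eseries_mkcond.
rewrite integral_nneseries//.
- rewrite [RHS]eseries_mkcond; apply: eq_eseriesr => i _.
  by case: ifP => // _; exact: integral0.
- by move=> i; case: (P i) => //; exact: measurable_cst.
- by move=> i w _; case: ifP.
Qed.

End countable_sum.

Section average.
Context {R : realType} {A : pointedType}.
Hypothesis cA : countable [set: A].
Implicit Types p h : A -> R.

Definition avg p h : R := fine (\esum_(s in [set: A]) (p s * h s)%:E).

Definition pmass p := (forall s, 0 <= p s) /\ (\esum_(s in [set: A]) (p s)%:E = 1)%E.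

Lemma esum_avg p h K : pmass p -> (forall s, 0 <= h s <= K) ->
  (\esum_(s in [set: A]) (p s * h s)%:E = (avg p h)%:E)%E.
Proof.
move=> [p0 p1] hK; rewrite /avg fineK// ge0_fin_numE; last first.
  apply: esum_ge0 => s _; rewrite lee_fin mulr_ge0//.
  by case/andP: (hK s).
have K0 : 0 <= K by case/andP: (hK point) => /le_trans; apply.
apply: (@le_lt_trans _ _ (\esum_(s in [set: A]) (K%:E * (p s)%:E))%E).
  apply: le_esum => s _; rewrite -EFinM lee_fin mulrC ler_wpM2r//.
  by case/andP: (hK s).
by rewrite ge0_esumZl// p1 mule1 ltry.
Qed.

Lemma avg_cst p (k : R) : 0 <= k -> pmass p -> avg p (fun=> k) = k.
Proof.
move=> k0 [p0 p1]; rewrite /avg.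
under eq_esum do rewrite mulrC EFinM.
by rewrite ge0_esumZl// p1 mule1.
Qed.

Lemma avg_le_affine p h f (a b K L : R) : pmass p ->
  (forall s, 0 <= h s <= K) -> (forall s, 0 <= f s <= L) ->
  (forall s, f s <= a + b * h s) -> avg p f <= a + b * avg p h.
Proof.
move=> pp hK fL fab; have [p0 p1] := pp.
(* Only sums of nonnegative terms are manipulated: [a] and [b], of any sign, are split into positive
   and negative parts, and the negative parts go to the left-hand side. *)
pose an := Num.max (- a) 0; pose ap := Num.max a 0.
pose bn := Num.max (- b) 0; pose bp := Num.max b 0.
have an0 : 0 <= an by rewrite le_max lexx orbT.
have ap0 : 0 <= ap by rewrite le_max lexx orbT.
have bn0 : 0 <= bn by rewrite le_max lexx orbT.
have bp0 : 0 <= bp by rewrite le_max lexx orbT.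
have aE : a = ap - an by rewrite /ap /an /Num.max; do 2 case: ifPn; lra.
have bE : b = bp - bn by rewrite /bp /bn /Num.max; do 2 case: ifPn; lra.
have h0 s : 0 <= h s by case/andP: (hK s).
have f0 s : 0 <= f s by case/andP: (fL s).
have lin (c d : R) : 0 <= c -> 0 <= d ->
    (\esum_(s in [set: A]) (p s * (c + d * h s))%:E = (c + d * avg p h)%:E)%E.
  move=> c0 d0.
  rewrite (eq_esum (b := fun s => c%:E * (p s)%:E + d%:E * (p s * h s)%:E)%E);
    last by move=> s _; rewrite -!EFinM -EFinD; congr EFin; ring.
  rewrite esumD; [|by move=> s _; rewrite -EFinM lee_fin mulr_ge0..|]; last first.
    by move=> s _; rewrite -EFinM lee_fin !mulr_ge0.
  rewrite !ge0_esumZl//; last by move=> s; rewrite lee_fin mulr_ge0.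
  by rewrite p1 mule1 (esum_avg pp hK) -EFinM -EFinD.
have : (\esum_(s in [set: A]) (p s * f s)%:E +
        \esum_(s in [set: A]) (p s * (an + bn * h s))%:E <=
        \esum_(s in [set: A]) (p s * (ap + bp * h s))%:E)%E.
  rewrite -esumD; [|by move=> s _; rewrite lee_fin mulr_ge0// ?addr_ge0// mulr_ge0..].
  apply: le_esum => s _; rewrite -EFinD lee_fin -mulrDr ler_wpM2l//.
  by have := fab s; rewrite aE bE; lra.
rewrite (esum_avg pp fL) !lin// -EFinD lee_fin aE bE; lra.
Qed.

Lemma avg_bounds p h K : pmass p -> (forall s, 0 <= h s <= K) ->
  0 <= avg p h <= K.
Proof.
move=> pp hK; apply/andP; split.
  rewrite -lee_fin -(esum_avg pp hK); apply: esum_ge0 => s _.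
  by rewrite lee_fin mulr_ge0//; [exact: pp.1|case/andP: (hK s)].
have := @avg_le_affine p h h K 0 K K pp hK hK.
by rewrite mul0r addr0; apply=> s; rewrite mul0r addr0; case/andP: (hK s).
Qed.

Lemma exists_inf h K : (forall s, 0 <= h s <= K) ->
  exists a, [/\ 0 <= a, forall s, a <= h s &
    forall x, (forall s, x <= h s) -> x <= a].
Proof.
move=> hK; have ne : range h !=set0 by exists (h point), point.
exists (inf (range h)); split.
- by apply: lb_le_inf => // _ [s _ <-]; case/andP: (hK s).
- move=> s; apply: ge_inf; last by exists s.
  by exists 0 => _ [t _ <-]; case/andP: (hK t).
- by move=> x xh; apply: lb_le_inf => // _ [s _ <-].
Qed.

(* [avg p h1 <= avg p k] with [k := min (h2 + a) (inf h2 + b)], and replacing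
   [p] by [p'] costs at most the total variation times the oscillation [b - a]
   of [k]. *)
Lemma avg_coupling p p' h1 h2 (a b v K : R) : pmass p -> pmass p' ->
  (forall s, 0 <= h1 s <= K) -> (forall s, 0 <= h2 s <= K) ->
  0 <= a <= b ->
  (forall s, h1 s <= h2 s + a) -> (forall s t, h1 s <= h2 t + b) ->
  (2^-1%:E * (\esum_(s in [set: A]) `|p s - p' s|%:E) <= v%:E)%E ->
  avg p h1 <= avg p' h2 + (1 - v) * a + v * b.
Proof.
move=> pp pp' h1K h2K /andP[a0 ab] h12 h12' tv.
have [i [i0 ih2 hi]] := exists_inf h2K.
have h1i s : h1 s <= i + b by rewrite -lerBlDr; apply: hi => t; rewrite lerBlDr.
(* The midpoint of [[i + a, i + b]], where [k] takes its values. As [p] and [p'] have equal mass,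
   [k] may be recentred at [m], which leaves [(b - a) / 2] times the sum of [|p s - p' s|], at most
   [(b - a) * v]. *)
pose m := i + (a + b) / 2.
have m0 : 0 <= m by rewrite /m; lra.
pose D s := `|p s - p' s|.
have pt s : p s * h1 s + p' s * m <= p' s * (h2 s + a) + p s * m + (b - a) / 2 * D s.
  have p0 := pp.1 s; have p'0 := pp'.1 s.
  pose k := Num.min (h2 s + a) (i + b).
  have k1 : k <= h2 s + a by rewrite ge_min lexx.
  have k2 : h1 s <= k by rewrite le_min h12 h1i.
  have k3 : `|k - m| <= (b - a) / 2.
    rewrite ler_norml /k /m; have := ih2 s; rewrite /Num.min.
    by case: ifPn; rewrite -?leNgt => *; apply/andP; split; lra.
  have : (p s - p' s) * (k - m) <= (b - a) / 2 * D s.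
    rewrite (le_trans (ler_norm _))// normrM mulrC ler_wpM2r//.
  have : p s * h1 s <= p s * k by rewrite ler_wpM2l.
  have : p' s * k <= p' s * (h2 s + a) by rewrite ler_wpM2l.
  by lra.
have h10 s : 0 <= h1 s by case/andP: (h1K s).
have h20 s : 0 <= h2 s by case/andP: (h2K s).
have cstE p1 : pmass p1 -> (\esum_(s in [set: A]) (p1 s * m)%:E = m%:E)%E.
  by move=> p1p; rewrite (@esum_avg _ (fun=> m) m) ?avg_cst// => s; rewrite m0 lexx.
have h2aK s : 0 <= h2 s + a <= K + a.
  by have /andP[? ?] := h2K s; apply/andP; split; lra.
have : ((\esum_(s in [set: A]) (p s * h1 s)%:E) + (\esum_(s in [set: A]) (p' s * m)%:E) <=
   (\esum_(s in [set: A]) (p' s * (h2 s + a))%:E) + (\esum_(s in [set: A]) (p s * m)%:E) +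
   ((b - a) / 2)%:E * (\esum_(s in [set: A]) (D s)%:E))%E.
  have ba0 : 0 <= (b - a) / 2 by lra.
  have D0 s : 0 <= D s by exact: normr_ge0.
  rewrite -ge0_esumZl//.
  rewrite -!esumD; [by apply: le_esum => s _; rewrite -?EFinM -!EFinD lee_fin pt
    |by move=> s _; rewrite -?EFinM -?EFinD lee_fin;
      do ?[exact: ba0 | exact: h10 | exact: h20 | exact: pp.1 | exact: pp'.1
          | done | apply: addr_ge0 | apply: mulr_ge0]..].
rewrite (esum_avg pp h1K) !cstE// (esum_avg pp' h2aK).
have : ((\esum_(s in [set: A]) (D s)%:E) <= (2 * v)%:E)%E.
  by move: tv; rewrite lee_pdivrMl// -EFinM.
have : (0 <= (\esum_(s in [set: A]) (D s)%:E))%E.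
  by apply: esum_ge0 => s _; rewrite lee_fin; exact: normr_ge0.
case: (\esum_(s in [set: A]) (D s)%:E) => //= d _; rewrite lee_fin => dv.
rewrite -EFinM -!EFinD lee_fin => H.
have Ha : avg p' (fun s => h2 s + a) <= a + 1 * avg p' h2.
  by apply: avg_le_affine h2aK _ => // s; lra.
have : (b - a) / 2 * d <= (b - a) / 2 * (2 * v) by rewrite ler_wpM2l//; lra.
by lra.
Qed.

(** By convexity the exponential lies below its chord over the range [[i, i + c]] of [h]; averaging
    the chord reduces the claim to a law on the two endpoints. *)
Lemma avg_hoeffding p h theta c K : pmass p -> (forall s, 0 <= h s <= K) ->
  (forall s t, h s <= h t + c) ->
  avg p (fun s => expR (theta * h s)) <=
    expR (theta * avg p h + theta ^+ 2 * c ^+ 2 / 8).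
Proof.
move=> pp hK hc.
have eK s : 0 <= expR (theta * h s) <= expR (`|theta| * K).
  rewrite expR_ge0 ler_expR (le_trans (ler_norm _))// normrM ler_wpM2l//.
  by have /andP[h0] := hK s; rewrite ger0_norm.
have c0 : 0 <= c by have := hc point point; lra.
have [i [i0 ih hi]] := exists_inf hK.
have hic s : h s <= i + c by rewrite -lerBlDr; apply: hi => t; rewrite lerBlDr.
have [cE|cn0] := eqVneq c 0.
  have hE : h = fun=> i.
    by apply/funext => s; apply/le_anti; rewrite ih -{1}[i]addr0 -cE hic.
  rewrite hE !avg_cst ?expR_ge0// ler_expR.
  by rewrite cE; lra.
have {}c0 : 0 < c by rewrite lt_neqAle eq_sym cn0.
pose E := expR (theta * c).
(* The mass at [i + c] of the two-point law on [i] and [i + c] that has the same mean as [h]. *)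
pose P := (avg p h - i) / c.
have mle := @avg_le_affine p h h i 1 K K pp hK hK.
have P01 : 0 <= P <= 1.
  have h1 : avg p h <= i + c.
    have := @avg_le_affine p h h (i + c) 0 K K pp hK hK; rewrite mul0r addr0; apply=> s.
    by rewrite mul0r addr0.
  have h2 : i <= avg p h.
    have := @avg_le_affine p h (fun=> i) 0 1 K i pp hK.
    rewrite avg_cst// add0r mul1r; apply=> s; first by rewrite i0 lexx.
    by rewrite add0r mul1r.
  by rewrite /P ler_pdivlMr// mul0r ler_pdivrMr// mul1r; apply/andP; split; lra.
have cvx s : expR (theta * h s) <=
    expR (theta * i) * (1 - (E - 1) * i / c) + expR (theta * i) * (E - 1) / c * h s.
  pose t := (h s - i) / c.
  have t01 : 0 <= t <= 1.
    rewrite /t ler_pdivlMr// mul0r ler_pdivrMr// mul1r subr_ge0 ih/=.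
    by rewrite lerBlDl hic.
  have -> : theta * h s = theta * i + t * (theta * c) by rewrite /t; field.
  have -> : expR (theta * i) * (1 - (E - 1) * i / c) +
      expR (theta * i) * (E - 1) / c * h s = expR (theta * i) * (1 - t + t * E).
    by rewrite /t; field.
  rewrite expRD ler_wpM2l ?expR_ge0//.
  have /andP[t0 t1] := t01.
  have := convex_expR (Itv01 t0 t1) (theta * c) 0.
  rewrite !convRE /= expR0 mulr0 addr0 mulr1 /unstable.onem [leRHS]addrC; exact.
apply: (le_trans (avg_le_affine pp hK eK cvx)).
have -> : expR (theta * i) * (1 - (E - 1) * i / c) +
      expR (theta * i) * (E - 1) / c * avg p h = expR (theta * i) * (1 - P + P * E).
  by rewrite /P; field.
apply: (le_trans (ler_wpM2l (expR_ge0 _) (hoeffding_two_points (theta * c) P01))).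
rewrite -expRD ler_expR le_eqVlt; apply/orP; left; apply/eqP.
by rewrite /P; field.
Qed.

End average.

(** * The transfer operator *)

Definition scons (A : Type) (s : A) (x : pasts A) : pasts A :=
  fun k => if k is k'.+1 then x k' else s.

Definition agree (A : Type) (l : nat) (z z' : pasts A) : Prop :=
  forall k, (k < l)%N -> z k = z' k.

Lemma agree_scons (A : Type) l s (z z' : pasts A) :
  agree l z z' -> agree l.+1 (scons s z) (scons s z').
Proof. by move=> zz' [|k] //=; exact: zz'. Qed.

(** Uniform continuity when pasts sharing many recent coordinates are close; one inequality suffices
    because [agree] is symmetric. *)
Definition unif_cont (R : realType) (A : Type) (h : pasts A -> R) : Prop :=
  forall e, 0 < e ->
    exists l, forall z z' : pasts A, agree l z z' -> h z <= h z' + e.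

Section kernel.
Context {R : realType} {A : pointedType} (g : A -> pasts A -> R).
Hypothesis cA : countable [set: A].
Hypothesis g_ker : is_prob_kernel g.
Hypothesis g_pos : 0 < Gamma g.

Definition transfer (h : pasts A -> R) (x : pasts A) : R :=
  avg (g^~ x) (fun s => h (scons s x)).

Let V (l : nat) : R := fine (Var g l).

Lemma pmass_kernel x : pmass (g^~ x).
Proof. by split; [move=> s; case/andP: (g_ker.1 s x)|exact: g_ker.2]. Qed.

Let Var_ge0 l : (0 <= Var g l)%E.
Proof.
apply: ereal_sup_ubound; exists point, point; split=> //.
by rewrite esum1 ?mule0// => s _; rewrite subrr normr0.
Qed.

Let Var_le1 l : (Var g l <= 1)%E.
Proof.
apply: ge_ereal_sup => _ [z [z' [_ ->]]].
rewrite lee_pdivrMl// mule1.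
apply: (@le_trans _ _ (\esum_(s in [set: A]) ((g s z)%:E + (g s z')%:E))%E).
  apply: le_esum => s _; rewrite -EFinD lee_fin.
  have p0 := (pmass_kernel z).1 s; have p'0 := (pmass_kernel z').1 s.
  by rewrite (le_trans (ler_normB _ _))// !ger0_norm.
rewrite esumD; [|by move=> s _; rewrite lee_fin; exact: (pmass_kernel _).1..].
by rewrite !g_ker.2 -EFinD.
Qed.

Let VarE l : Var g l = (V l)%:E.
Proof.
by rewrite fineK// ge0_fin_numE// (le_lt_trans (Var_le1 l))// ltry.
Qed.

Lemma tv_le_Var l z z' : agree l z z' ->
  (2^-1%:E * (\esum_(s in [set: A]) `|g s z - g s z'|%:E) <= (fine (Var g l))%:E)%E.
Proof.
by move=> zz'; rewrite -/(V l) -VarE; apply: ereal_sup_ubound; exists z, z'.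
Qed.

Lemma fine_Var_bounds l : 0 <= fine (Var g l) <= 1.
Proof. by rewrite -!lee_fin -/(V l) -VarE Var_ge0 Var_le1. Qed.

Lemma fine_Var_noninc l : fine (Var g l.+1) <= fine (Var g l).
Proof.
rewrite -lee_fin -!/(V _) -!VarE; apply: ereal_sup_le => v [z [z' [zz' ->]]].
by exists z, z'; split=> // k kl; apply: zz'; rewrite ltnS ltnW.
Qed.

(** The partial products are nonincreasing and bounded below by 0, so that [limn] is a genuine limit
    and lies below each of them. *)
Lemma Gamma_le_prod m : Gamma g <= \prod_(0 <= i < m) (1 - fine (Var g i)).
Proof.
pose u (n : nat) : R := \prod_(0 <= j < n) (1 - fine (Var g j)).
have u0 n : 0 <= u n.
  by apply: prodr_ge0 => i _; rewrite subr_ge0; case/andP: (fine_Var_bounds i).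
have noninc : {homo u : n k / (n <= k)%N >-> k <= n}.
  apply: homo_leq => [x //|x y z xy yz|n]; first exact: le_trans yz xy.
  rewrite /u big_nat_recr//= -/(u n) ler_piMr//.
  by rewrite gerBl; case/andP: (fine_Var_bounds n).
apply: (nonincreasing_cvgn_ge noninc).
apply: nonincreasing_is_cvgn noninc _.
by exists 0 => _ [n _ <-].
Qed.

(** [Gamma g * Var g i] is at most the [i]-th return weight, and these weights sum to at most 1: the
    variations are summable. *)
Lemma fine_Var_small e : 0 < e -> exists l, fine (Var g l) <= e.
Proof.
move=> e0.
have S n : \sum_(0 <= i < n) Gamma g * fine (Var g i) <= 1.
  apply: (@le_trans _ _ (\sum_(0 <= i < n) return_weight (fine \o Var g) 0 i)).
    apply: ler_sum => i _; rewrite ler_wpM2r ?Gamma_le_prod//.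
    by case/andP: (fine_Var_bounds i).
  rewrite sum_return_weight gerBl prodr_ge0// => i _.
  by rewrite subr_ge0; case/andP: (fine_Var_bounds i).
have G0 n : 0 <= Gamma g * fine (Var g n).
  by rewrite mulr_ge0 ?(ltW g_pos)//; case/andP: (fine_Var_bounds n).
have [l _ le] := exists_small_term 0 G0 S (mulr_gt0 g_pos e0).
by exists l; move: le; rewrite ler_pM2l.
Qed.

Lemma esum_transfer (h : pasts A -> R) (K : R) x : (forall z, 0 <= h z <= K) ->
  (\esum_(s in [set: A]) (g s x * h (scons s x))%:E = (transfer h x)%:E)%E.
Proof. by move=> hK; apply: (@esum_avg _ _ cA _ _ K (pmass_kernel x)). Qed.

Lemma transfer_bounds (h : pasts A -> R) (K : R) : (forall z, 0 <= h z <= K) ->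
  forall z, 0 <= transfer h z <= K.
Proof. by move=> hK z; apply: avg_bounds => //; exact: pmass_kernel. Qed.

Lemma transfer_diff (h : pasts A -> R) (a b K : R) l z z' :
  (forall z, 0 <= h z <= K) -> agree l z z' -> 0 <= a <= b ->
  (forall s, h (scons s z) <= h (scons s z') + a) ->
  (forall s t, h (scons s z) <= h (scons t z') + b) ->
  transfer h z <=
    transfer h z' + (1 - fine (Var g l)) * a + fine (Var g l) * b.
Proof.
move=> hK zz' ab ha hb; apply: (@avg_coupling _ _ cA _ _ _ _ _ _ _ K) => //.
- exact: pmass_kernel.
- exact: pmass_kernel.
- exact: tv_le_Var.
Qed.

Lemma unif_cont_transfer (h : pasts A -> R) (K : R) :
  (forall z, 0 <= h z <= K) -> unif_cont h -> unif_cont (transfer h).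
Proof.
move=> hK uch e e0.
have K0 : 0 <= K by case/andP: (hK point) => /le_trans; apply.
have e20 : 0 < e / 2 by rewrite divr_gt0.
have [l hl] := uch _ e20.
(* The coupling is used with cost [e / 2] on agreement and [K + e] on disagreement; the added [e]
   keeps the divisor positive and the costs ordered. *)
have eK : 0 < e / 2 / (K + e) by rewrite divr_gt0// ltr_wpDl.
have [l' Vl'] := fine_Var_small eK.
have noninc i j : (i <= j)%N -> fine (Var g j) <= fine (Var g i).
  elim: j => [|j IH]; first by rewrite leqn0 => /eqP ->.
  rewrite leq_eqVlt => /predU1P[->//|]; rewrite ltnS => /IH.
  exact/le_trans/fine_Var_noninc.
exists (maxn l l') => z z' zz'.
have b0 : 0 <= e / 2 <= K + e by apply/andP; split; lra.
apply: (le_trans (transfer_diff hK zz' b0 _ _)).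
- move=> s; apply: hl => -[//|k] kl /=; apply: zz'.
  by rewrite leq_max (ltnW kl).
- by move=> s t; have := hK (scons s z); have := hK (scons t z'); lra.
set v := fine _.
have v01 : 0 <= v <= 1 := fine_Var_bounds _.
have : v * (K + e) <= e / 2.
  rewrite -ler_pdivlMr; last by lra.
  apply: le_trans Vl'; apply: noninc; exact: leq_maxr.
have : 0 <= v * (e / 2) by rewrite mulr_ge0//; lra.
by lra.
Qed.

Lemma transfer_expR_le (h : pasts A -> R) (theta c K : R) x :
  (forall z, 0 <= h z <= K) ->
  (forall s t, h (scons s x) <= h (scons t x) + c) ->
  transfer (fun z => expR (theta * h z)) x <=
    expR (theta * transfer h x + theta ^+ 2 * c ^+ 2 / 8).
Proof.
by move=> hK hc; apply: (@avg_hoeffding _ _ cA _ _ _ _ K (pmass_kernel x)).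
Qed.

Section iterates.
Variables (h : pasts A -> R) (K : R) (e : nat -> R) (N : nat).
Hypothesis hK : forall z, 0 <= h z <= K.
Hypothesis e_ge0 : forall i, 0 <= e i.
Hypothesis h_osc : forall z z', h z <= h z' + \sum_(0 <= i < N) e i * (z i != z' i)%:R.

Let iterate m := iter m transfer h.

Let c := total_osc (fine \o Var g) e.

Lemma iterate_bounds m z : 0 <= iter m transfer h z <= K.
Proof. by elim: m z => //= m IH; exact: transfer_bounds. Qed.

(** The direct dependence of [h_m] on its past: [m] coordinates have been averaged out, so position
    [i] now carries the weight [e (m + i)]. *)
Let tail m z z' := \sum_(0 <= i < N) e (m + i)%N * (z i != z' i :> A)%:R.

Let tail_ge0 m z z' : 0 <= tail m z z'.
Proof. by apply: sumr_ge0 => i _; rewrite mulr_ge0. Qed.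

Let tail_scons m s t z z' :
  tail m (scons s z) (scons t z') <= e m * (s != t)%:R + tail m.+1 z z'.
Proof.
rewrite /tail; case: N => [|N']; first by rewrite !big_nil addr0 mulr_ge0.
rewrite big_nat_recl//= addn0 lerD2l big_nat_recr//=.
under eq_bigr do rewrite -addSnnS.
by rewrite lerDl mulr_ge0.
Qed.

(** One step of the coupling is the recursion of [spread]: either the new letters coincide and the
    agreement grows to [l.+1] ([step']), or, with weight [V l], it restarts from 0 at the extra cost
    [e m] ([step]). *)
Let iterate_osc m l z z' : agree l z z' ->
  iterate m z <= iterate m z' + spread (fine \o Var g) e m l + tail m z z'.
Proof.
elim: m l z z' => [|m IH] l z z' zz'; first by rewrite /= addr0; exact: h_osc.
have S0 k := spread_ge0 fine_Var_bounds e_ge0 m k.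
have Sle := spread_le0 fine_Var_bounds e_ge0 fine_Var_noninc m l.+1.
have := S0 l.+1; have := tail_ge0 m.+1 z z'; have := e_ge0 m => em W0 Sl0.
have step s t : iterate m (scons s z) <= iterate m (scons t z') +
    (e m + spread (fine \o Var g) e m 0 + tail m.+1 z z').
  have ag0 : agree 0 (scons s z) (scons t z') by [].
  have := IH 0 _ _ ag0; have := tail_scons m s t z z'.
  by case: (s != t); rewrite ?mulr1 ?mulr0; lra.
have step' s : iterate m (scons s z) <= iterate m (scons s z') +
    (spread (fine \o Var g) e m l.+1 + tail m.+1 z z').
  have := IH _ _ _ (agree_scons s zz'); have := tail_scons m s s z z'.
  by rewrite eqxx mulr0; lra.
have ab : 0 <= spread (fine \o Var g) e m l.+1 + tail m.+1 z z' <=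
    e m + spread (fine \o Var g) e m 0 + tail m.+1 z z'.
  by apply/andP; split; lra.
have := transfer_diff (iterate_bounds m) zz' ab step' step.
by rewrite /iterate /=; lra.
Qed.

Lemma iterate_osc_head m s t z :
  iter m transfer h (scons s z) <= iter m transfer h (scons t z) + c m.
Proof.
have ag0 : agree 0 (scons s z) (scons t z) by [].
have := iterate_osc m ag0; have := tail_scons m s t z z.
have -> : tail m.+1 z z = 0.
  by rewrite /tail big1// => i _; rewrite eqxx mulr0.
have := e_ge0 m; rewrite /c /total_osc /iterate.
by case: (s != t); rewrite ?mulr1 ?mulr0; lra.
Qed.

(** After [N] steps no direct dependence on the past is left: [tail] and [e m] vanish, and [c m]
    bounds the full oscillation. *)
Lemma iterate_osc_all (e_supp : forall i, (N <= i)%N -> e i = 0) m z z' :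
  (N <= m)%N -> iter m transfer h z <= iter m transfer h z' + c m.
Proof.
move=> Nm; have ag0 : agree 0 z z' by [].
have := iterate_osc m ag0; rewrite /c /total_osc e_supp// add0r.
rewrite (_ : tail m z z' = 0) ?addr0//.
by rewrite /tail big1// => i _; rewrite e_supp ?mul0r// (leq_trans Nm)// leq_addr.
Qed.

Lemma unif_cont_base : unif_cont h.
Proof.
move=> d d0; exists N => z z' zz'; rewrite (le_trans (h_osc z z'))// lerD2l.
by rewrite big_nat big1 ?ltW// => i /andP[_ iN]; rewrite zz'// eqxx mulr0.
Qed.

Lemma unif_cont_iterate m : unif_cont (iter m transfer h).
Proof.
elim: m => [|m IH] /=; first exact: unif_cont_base.
exact: unif_cont_transfer (iterate_bounds m) IH.
Qed.

End iterates.
End kernel.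

Lemma unif_cont_expR (R : realType) (A : Type) (h : pasts A -> R) (theta K : R) :
  (forall z, 0 <= h z <= K) -> unif_cont h ->
  unif_cont (fun z => expR (theta * h z)).
Proof.
move=> hK uch e e0.
pose B := expR (`|theta| * K).
have B0 : 0 < B := expR_gt0 _.
have th0 : 0 < `|theta| + 1 by rewrite ltr_wpDl.
(* On the range considered the exponential has Lipschitz constant [B * |theta|] in [h], through
   [1 + x <= expR x]; the [+ 1] avoids division by zero when [theta] is 0. *)
have d0 : 0 < e / (B * (`|theta| + 1)) by rewrite divr_gt0// mulr_gt0.
have [l hl] := uch _ d0.
exists l => z z' zz'.
set d := e / _ in hl d0.
have z'z : agree l z' z by move=> k kl; rewrite zz'.
have hd : `|h z - h z'| <= d.
  have := hl _ _ zz'; have := hl _ _ z'z; rewrite ler_norml => ? ?.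
  by apply/andP; split; lra.
have xy : theta * h z - theta * h z' <= `|theta| * d.
  by rewrite -mulrBr (le_trans (ler_norm _))// normrM ler_wpM2l.
have xB : expR (theta * h z) <= B.
  rewrite ler_expR (le_trans (ler_norm _))// normrM ler_wpM2l//.
  by have /andP[h0] := hK z; rewrite ger0_norm.
have td0 : 0 <= `|theta| * d by rewrite mulr_ge0 // ltW.
have : expR (theta * h z) * (1 - `|theta| * d) <= expR (theta * h z').
  have -> : theta * h z' = theta * h z + (theta * h z' - theta * h z) by lra.
  rewrite expRD ler_wpM2l ?expR_ge0//.
  apply: le_trans (expR_ge1Dx _); lra.
have : expR (theta * h z) * (`|theta| * d) <= B * (`|theta| * d) by rewrite ler_wpM2r.
have : B * (`|theta| * d) <= e.
  rewrite mulrA /d mulrCA ger_pMr// ler_pdivrMr ?mul1r ?ler_pM2l ?mulr_gt0//.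
  by rewrite lerDl.
by lra.
Qed.

(** * Conditioning on the past *)

(** The sum is [c] times the number of multiples of [c] up to [x]; counting [i = 0] makes it an
    approximation from above. *)
Lemma staircase_bounds (R : realType) (c x : R) (N : nat) : 0 <= c -> 0 <= x ->
  x <= c * N%:R ->
  x <= \sum_(0 <= i < N.+1) c * (c * i%:R <= x)%R%:R <= x + c.
Proof.
move=> c0 x0 xN; apply/andP; split.
  elim: N xN => [|N IH] xN.
    by rewrite (le_trans xN)// mulr0 big_nat1 mulr_ge0.
  have [xN'|Nx] := leP x (c * N%:R).
    by rewrite big_nat_recr//= (le_trans (IH xN'))// lerDl mulr_ge0.
  rewrite big_nat_recr//= ler_wpDr ?mulr_ge0// (le_trans xN)//.
  rewrite (eq_big_nat _ _ (F2 := fun=> c)); last first.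
    move=> i /andP[_]; rewrite ltnS => iN.
    by rewrite (le_trans _ (ltW Nx)) ?mulr1// ler_wpM2l// ler_nat.
  by rewrite sumr_const_nat subn0 mulr_natr.
elim: N.+1 => [|M IH]; first by rewrite big_nil addr_ge0.
rewrite big_nat_recr//=; have [Mx|_] := leP (c * M%:R) x; last by rewrite mulr0 addr0.
rewrite mulr1 lerD2r (le_trans _ Mx)//.
apply: (@le_trans _ _ (\sum_(0 <= i < M) c)).
  by apply: ler_sum => i _; case: (c * i%:R <= x); rewrite ?mulr1// mulr0.
by rewrite sumr_const_nat subn0 mulr_natr.
Qed.

Lemma measurable_superlevel (d : measure_display) (S : measurableType d)
    (R : realType) (f : S -> R) (t : R) :
  measurable_fun [set: S] f -> measurable [set w | t <= f w].
Proof.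
move=> mf; rewrite (_ : [set w | _] = f @^-1` `[t, +oo[); last first.
  by apply/seteqP; split=> w /=; rewrite in_itv/= andbT.
by rewrite -[X in measurable X]setTI; exact: mf.
Qed.

Section level_sets.
Context {d : measure_display} {S : measurableType d} {R : realType}.
Variable mu : probability S R.

(* Approximating [H] within [K / N] by a combination of indicators of its level
   sets. *)
Let le_integralM_level_sets (H u v : S -> R) (K : R) :
  measurable_fun [set: S] H -> measurable_fun [set: S] u ->
  measurable_fun [set: S] v ->
  (forall w, 0 <= H w <= K) -> (forall w, 0 <= u w <= 1) ->
  (forall w, 0 <= v w <= 1) ->
  (forall t, \int[mu]_w (\1_[set w | t <= H w] w * u w)%:E =
             \int[mu]_w (\1_[set w | t <= H w] w * v w)%:E)%E ->
  (\int[mu]_w (H w * u w)%:E <= \int[mu]_w (H w * v w)%:E)%E.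
Proof.
move=> mH mu_ mv HK u01 v01 uv.
have K0 : 0 <= K by case/andP: (HK point) => /le_trans; apply.
have mL t : measurable [set w | t <= H w] by exact: measurable_superlevel.
have mI t (f : S -> R) : measurable_fun [set: S] f ->
    measurable_fun [set: S] (fun w => (\1_[set w | t <= H w] w * f w)%:E).
  by move=> mf; apply/measurable_EFinP/measurable_funM => //; exact: measurable_indic.
apply/lee_addgt0Pr => e e0.
pose N := (Num.truncn (K / e)).+1.
pose c := K / N%:R.
have c0 : 0 <= c by rewrite divr_ge0.
have ce : c <= e.
  by rewrite ler_pdivrMr ?ltr0n// mulrC -ler_pdivrMr// ltW// truncnS_gt.
pose J (w : S) := \sum_(0 <= i < N.+1) c * (c * i%:R <= H w)%R%:R.
have HJ w : H w <= J w <= H w + c.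
  have /andP[H0 HwK] := HK w; apply: staircase_bounds => //.
  by rewrite /c mulfVK// pnatr_eq0.
have JE (f : S -> R) : measurable_fun [set: S] f -> (forall w, 0 <= f w <= 1) ->
    (\int[mu]_w (J w * f w)%:E = \sum_(0 <= i < N.+1)
      c%:E * \int[mu]_w (\1_[set w | (c * i%:R <= H w)%R] w * f w)%:E)%E.
  move=> mf f01.
  have f0 w : 0 <= f w by case/andP: (f01 w).
  transitivity (\int[mu]_w \sum_(0 <= i < N.+1)
      (c%:E * (\1_[set w | (c * i%:R <= H w)%R] w * f w)%:E))%E.
    apply: eq_integral => w _; rewrite /J mulr_suml -sumEFin.
    apply: eq_bigr => i _; rewrite -EFinM mulrA indicE; congr (_ * _ * _)%:E.
    by rewrite (_ : (w \in _) = (c * i%:R <= H w)) //; apply/idP/idP; rewrite inE.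
  rewrite ge0_integral_sum//.
  - apply: eq_bigr => i _; rewrite ge0_integralZl_EFin//.
    + by move=> w _; rewrite lee_fin mulr_ge0.
    + exact: mI.
  - by move=> i; apply: measurable_funeM; exact: mI.
  - by move=> i w _; rewrite -EFinM lee_fin !mulr_ge0.
have mJ : measurable_fun [set: S] J.
  apply: measurable_sum => i; apply: measurable_funM => //.
  rewrite (_ : (fun w => _) = \1_[set w | (c * i%:R <= H w)%R]); last first.
    apply/funext => w; rewrite indicE; congr (nat_of_bool _)%:R.
    by apply/idP/idP; rewrite inE.
  exact: measurable_indic.
have mP (f k : S -> R) : measurable_fun [set: S] f -> measurable_fun [set: S] k ->
    measurable_fun [set: S] (fun w => (f w * k w)%:E).
  by move=> mf mk; apply/measurable_EFinP/measurable_funM.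
have H0 w : 0 <= H w by case/andP: (HK w).
have u0 w : 0 <= u w by case/andP: (u01 w).
have v0 w : 0 <= v w by case/andP: (v01 w).
have J0 w : 0 <= J w by case/andP: (HJ w) => /(le_trans (H0 w)).
apply: (@le_trans _ _ (\int[mu]_w (J w * u w)%:E)%E).
  apply: ge0_le_integral => //.
  - by move=> w _; rewrite lee_fin mulr_ge0.
  - exact: mP.
  - exact: mP.
  - by move=> w _; rewrite lee_fin ler_wpM2r//; case/andP: (HJ w).
rewrite (JE u)//; under eq_bigr do rewrite uv; rewrite -JE//.
apply: (@le_trans _ _ (\int[mu]_w ((H w * v w)%:E + (cst e%:E) w))%E).
  apply: ge0_le_integral => //.
  - by move=> w _; rewrite lee_fin mulr_ge0.
  - exact: mP.
  - by apply: emeasurable_funD => //; exact: mP.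
  - move=> w _; rewrite /= -EFinD lee_fin; have /andP[_ h1] := HJ w.
    have /andP[_ v1] := v01 w.
    apply: (le_trans (ler_wpM2r (v0 w) h1)); rewrite mulrDl lerD2l.
    by apply: le_trans ce; rewrite ler_piMr.
rewrite ge0_integralD//.
- by rewrite integral_cst//= probability_setT mule1.
- by move=> w _; rewrite lee_fin mulr_ge0.
- exact: mP.
- by move=> w _; rewrite lee_fin ltW.
Qed.

(** Passes from events to bounded functions in the defining identity of a conditional probability;
    the one-sided estimate is applied with [u] and [v] in both orders. *)
Lemma integralM_level_sets (H u v : S -> R) (K : R) :
  measurable_fun [set: S] H -> measurable_fun [set: S] u ->
  measurable_fun [set: S] v ->
  (forall w, 0 <= H w <= K) -> (forall w, 0 <= u w <= 1) ->
  (forall w, 0 <= v w <= 1) ->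
  (forall t, \int[mu]_w (\1_[set w | t <= H w] w * u w)%:E =
             \int[mu]_w (\1_[set w | t <= H w] w * v w)%:E)%E ->
  (\int[mu]_w (H w * u w)%:E = \int[mu]_w (H w * v w)%:E)%E.
Proof.
move=> mH mu_ mv HK u01 v01 uv; apply/le_anti/andP.
by split; apply: (@le_integralM_level_sets _ _ _ K).
Qed.

End level_sets.

(** * Measurability of functions of the past *)

Section paths_measurability.
Context {R : realType} {A : pointedType}.
Hypothesis cA : countable [set: A].
Implicit Type n : int.

Lemma measurable_past_events n (C : set (paths A)) :
  <<s @past_events A n >> C -> measurable C.
Proof.
apply: smallest_sub; first exact: sigma_algebra_measurable.
move=> _ [k [S [_ ->]]].
(* [S] is a countable union of singletons, and each singleton gives a cylinder with [i = j = k]. *)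
rewrite (_ : [set w | S (w k)] = \bigcup_(a in [set: A])
    (if a \in S then [set w : paths A | w k = a] else set0)); last first.
  apply/seteqP; split=> [w Sw|w [a _]] /=.
    by exists (w k) => //; rewrite mem_set.
  by case: ifPn => // /set_mem Sa /= ->.
apply: countable_bigcupT_measurable => // a; case: ifP => // _.
apply: sub_sigma_algebra; exists k, k, (fun=> a); apply/seteqP.
split=> w /= => [wa i|/(_ k)]; last by rewrite lexx; apply.
by move=> /le_anti <-.
Qed.

Lemma measurable_fun_past_events n (H : paths A -> R) :
  measurable_fun [set: g_sigma_algebraType (@past_events A n)]
    (H : g_sigma_algebraType (@past_events A n) -> R) ->
  measurable_fun [set: paths A] H.
Proof.
move=> mH _ Y mY; rewrite setTI; apply: (@measurable_past_events n).
by have := mH measurableT Y mY; rewrite setTI.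
Qed.

Let trunc l (z : pasts A) : pasts A := fun k => if (k < l)%N then z k else point.

(** A truncated past has countably many values, so an arbitrary [S] is allowed; the induction splits
    on the oldest coordinate that is kept. *)
Let measurable_trunc n l (S : set (pasts A)) :
  measurable ([set w | S (trunc l (past n w))]
    : set (g_sigma_algebraType (@past_events A n))).
Proof.
pose T' := g_sigma_algebraType (@past_events A n).
elim: l S => [|l IH] S.
  have E w : trunc 0 (past n w) = fun=> point by apply/funext.
  have [Sp|nSp] := pselect (S (fun=> point)).
    rewrite (_ : [set w | _] = setT); first exact: measurableT.
    by apply/seteqP; split=> w //= _; rewrite E.
  rewrite (_ : [set w | _] = set0); first exact: measurable0.
  by apply/seteqP; split=> w //=; rewrite E.
pose upd (a : A) (z : pasts A) : pasts A := fun k => if k == l then a else z k.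
rewrite (_ : [set w | _] = \bigcup_(a in [set: A])
    ([set w : T' | w (n - l.+1%:Z) = a] `&`
     [set w : T' | S (upd a (trunc l (past n w)))])); last first.
  have E w : trunc l.+1 (past n w) = upd (w (n - l.+1%:Z)) (trunc l (past n w)).
    apply/funext => k; rewrite /trunc /upd /past ltnS leq_eqVlt.
    by case: eqVneq => [->|].
  apply/seteqP; split=> [w Sw|w [a _ [wa Sw]]] /=.
    by exists (w (n - l.+1%:Z)) => //; split=> //=; rewrite -E.
  by rewrite E wa.
apply: countable_bigcupT_measurable => // a; apply: measurableI.
  apply: sub_sigma_algebra; exists (n - l.+1%:Z), [set a]; split=> //.
  by rewrite gtrDl oppr_lt0.
exact: (IH [set z | S (upd a z)]).
Qed.

(** [h] is the pointwise limit of its values at truncated pasts, which are measurable whatever [h]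
    is. *)
Lemma measurable_unif_cont n (h : pasts A -> R) : unif_cont h ->
  measurable_fun [set: g_sigma_algebraType (@past_events A n)]
    ((fun w => h (past n w)) : g_sigma_algebraType (@past_events A n) -> R).
Proof.
move=> uch.
apply: (@measurable_fun_cvg _ (g_sigma_algebraType (@past_events A n)) R setT
  (fun l w => h (trunc l (past n w)))).
  by move=> l _ Y mY; rewrite setTI; exact: (@measurable_trunc n l [set z | Y (h z)]).
move=> w _; apply/cvgrPdist_le => e e0.
have [l hl] := uch _ e0.
near=> m.
have zz' : agree l (past n w) (trunc m (past n w)).
  move=> k kl; rewrite /trunc (leq_trans kl)//; near: m.
  exact: nbhs_infty_ge.
have z'z : agree l (trunc m (past n w)) (past n w) by move=> k kl; rewrite zz'.
have := hl _ _ zz'; have := hl _ _ z'z; rewrite ler_norml => ? ?.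
by apply/andP; split; lra.
Unshelve. all: by end_near.
Qed.

Lemma measurable_unif_cont_paths n (h : pasts A -> R) : unif_cont h ->
  measurable_fun [set: paths A] (fun w => h (past n w)).
Proof.
move=> uch; apply: (@measurable_fun_past_events n).
exact: measurable_unif_cont.
Qed.

End paths_measurability.

Lemma past_succ (A : pointedType) (n : int) (w : paths A) :
  past (n + 1) w = scons (w n) (past n w).
Proof.
apply/funext => -[|k]; rewrite /past /=; first by rewrite addrK.
by congr w; rewrite (intS k.+1) opprD addrA addrK.
Qed.

(** * Integrating out one coordinate given its past *)

Section tower.
Context {R : realType} {A : pointedType}.
Variables (mu : probability (paths A) R) (g : A -> pasts A -> R).
Hypothesis cA : countable [set: A].
Hypothesis g_ker : is_prob_kernel g.
Hypothesis mu_g : compatible mu g.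
Hypothesis g_pos : 0 < Gamma g.

(** [g a] is the transfer of the indicator that the most recent letter is [a]. *)
Lemma unif_cont_kernel a : unif_cont (g a).
Proof.
pose h (z : pasts A) : R := (z 0 == a)%:R.
have -> : g a = transfer g h.
  apply/funext => z; rewrite /transfer /avg /h /=.
  rewrite (eq_esum (b := fun s => if s \in [set a] then (g s z)%:E else 0%E)).
    by rewrite -esum_mkcond esum_set1// lee_fin; case/andP: (g_ker.1 a z).
  by move=> s _; rewrite in_set1; case: (s == a); rewrite ?mulr1 ?mulr0.
apply: (@unif_cont_transfer _ _ _ cA g_ker g_pos _ 1).
  by move=> z; rewrite /h; case: (_ == _); rewrite lexx ler01.
by move=> e e0; exists 1 => z z' /(_ 0 isT) zz'; rewrite /h zz' lerDl ltW.
Qed.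

Let measurable_at n a : measurable [set w : paths A | w n = a].
Proof.
apply: (@measurable_past_events _ cA (n + 1)); apply: sub_sigma_algebra.
by exists n, [set a]; split=> //; rewrite ltrDl.
Qed.

(** The level sets of [H] belong to the sigma-algebra of the past, where the version [h] integrates
    to the probability of [w n = a]; [h] is then replaced by the kernel almost everywhere. *)
Lemma integral_kernel n a (H : paths A -> R) (K : R) :
  measurable_fun [set: g_sigma_algebraType (@past_events A n)]
    (H : g_sigma_algebraType (@past_events A n) -> R) ->
  (forall w, 0 <= H w <= K) ->
  (\int[mu]_w (H w * \1_[set w | w n = a] w)%:E =
   \int[mu]_w (H w * g a (past n w))%:E)%E.
Proof.
move=> mH HK.
have mG := measurable_unif_cont_paths cA n (unif_cont_kernel a).
apply: (@integralM_level_sets _ _ _ _ _ _ _ K) => //.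
- exact: (measurable_fun_past_events cA mH).
- by move=> w; rewrite indicE; case: (_ \in _); rewrite lexx ler01.
- by move=> w; exact: g_ker.1.
move=> t.
have Ct : <<s @past_events A n >> [set w | t <= H w].
  exact: (measurable_superlevel t mH).
have mC := measurable_past_events cA Ct.
have setE (f : paths A -> R) :
    (\int[mu]_w (\1_[set w | (t <= H w)%R] w * f w)%:E =
     \int[mu]_(w in [set w | (t <= H w)%R]) (f w)%:E)%E.
  rewrite [RHS]integral_mkcond epatch_indic; apply: eq_integral => w _ /=.
  by rewrite -EFinM mulrC.
rewrite !setE integral_indic//.
have [h [[mh ih hC] hg]] := mu_g n a.
rewrite setIC; apply: (etrans (esym (hC _ Ct))); apply: ae_eq_integral => //.
- apply/measurable_EFinP; apply: measurable_funTS.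
  exact: (measurable_fun_past_events cA mh).
- by apply/measurable_EFinP; apply: measurable_funTS.
- by apply: filterS hg => w -> _.
Qed.

(** Split according to the value [a] of coordinate [n], apply [integral_kernel] to the
    past-measurable factor [h (scons a (past n w))], and sum again over [a]. *)
Lemma integral_transfer n (h : pasts A -> R) (K : R) :
  (forall z, 0 <= h z <= K) -> unif_cont h ->
  (\int[mu]_w (h (past (n + 1) w))%:E =
   \int[mu]_w (transfer g h (past n w))%:E)%E.
Proof.
move=> hK uch.
have h0 z : 0 <= h z by case/andP: (hK z).
have g0 a z : 0 <= g a z by case/andP: (g_ker.1 a z).
have uca a : unif_cont (fun z => h (scons a z)).
  move=> e e0; have [l hl] := uch _ e0; exists l => z z' zz'.
  by apply: hl => -[//|k] kl /=; apply: zz'; exact: ltnW.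
have mha a := @measurable_unif_cont R A cA n _ (uca a).
have mha' a := measurable_unif_cont_paths cA n (uca a).
transitivity (\int[mu]_w \esum_(a in [set: A])
    (h (scons a (past n w)) * \1_[set w | w n = a] w)%:E)%E.
  apply: eq_integral => w _; rewrite past_succ.
  rewrite (eq_esum (b := fun a => if a \in [set w n] then
      (h (scons a (past n w)))%:E else 0%E)).
    by rewrite -esum_mkcond esum_set1// lee_fin.
  move=> a _; rewrite indicE in_set1.
  rewrite (_ : (w \in _) = (a == w n)); last first.
    by apply/idP/eqP; rewrite inE.
  by case: (a == w n); rewrite ?mulr1 ?mulr0.
rewrite ge0_integral_esum//; first last.
- by move=> a w; rewrite lee_fin mulr_ge0.
- by move=> a; apply/measurable_EFinP/measurable_funM.
rewrite (eq_esum (b := fun a => \int[mu]_w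
    (h (scons a (past n w)) * g a (past n w))%:E)%E); last first.
  by move=> a _; apply: (@integral_kernel n a _ K).
rewrite -ge0_integral_esum//; first last.
- by move=> a w; rewrite lee_fin mulr_ge0.
- move=> a; apply/measurable_EFinP/measurable_funM => //.
  exact: (measurable_unif_cont_paths cA n (unif_cont_kernel a)).
apply: eq_integral => w _; rewrite -(esum_transfer cA g_ker _ hK).
by apply: eq_esum => a _; rewrite mulrC.
Qed.

End tower.

(** * Moment generating function and tails *)

Section tail_bound.
Context {d : measure_display} {S : measurableType d} {R : realType}.
Variable mu : probability S R.

Let tail_one_sided (X : S -> R) (s u : R) : measurable_fun [set: S] X ->
  0 < s -> 0 < u ->
  (forall theta, \int[mu]_w (expR (theta * X w))%:E <=
     (expR (theta ^+ 2 * s / 8))%:E)%E ->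
  (mu [set w | (u <= X w)%R] <= (expR (- (2 * u ^+ 2 / s)))%:E)%E.
Proof.
(* Chernoff's method: this [theta] minimizes [theta ^+ 2 * s / 8 - theta * u]. *)
move=> mX s0 u0 mgf; pose theta := 4 * u / s.
have th0 : 0 <= theta by rewrite divr_ge0 ?mulr_ge0 ?ltW.
have mL : measurable [set w | u <= X w].
  exact: measurable_superlevel.
have mE : measurable_fun [set: S] (fun w => (expR (theta * X w))%:E).
  apply/measurable_EFinP; apply: measurableT_comp => //.
  exact: measurable_funM.
have -> : mu [set w | u <= X w] = (\int[mu]_w (\1_[set w | (u <= X w)%R] w)%:E)%E.
  by rewrite integral_indic// setIT.
apply: (@le_trans _ _ (\int[mu]_w
    ((expR (- (theta * u)))%:E * (expR (theta * X w))%:E))%E).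
  apply: ge0_le_integral => //.
  - exact/measurable_EFinP/measurable_indic.
  - exact: measurable_funeM.
  - move=> w _; rewrite -EFinM lee_fin -expRD indicE.
    case: (boolP (w \in _)) => [/set_mem/= uX|_]; last exact: expR_ge0.
    rewrite -expR0 ler_expR addrC -mulrBr mulr_ge0//.
    by rewrite subr_ge0.
rewrite ge0_integralZl_EFin ?expR_ge0//.
apply: (le_trans (lee_wpmul2l _ (mgf theta))); first by rewrite lee_fin expR_ge0.
rewrite -EFinM lee_fin -expRD ler_expR le_eqVlt; apply/orP; left; apply/eqP.
by rewrite /theta; field; exact: lt0r_neq0.
Qed.

Lemma subgaussian_tail (X : S -> R) (s u : R) : measurable_fun [set: S] X ->
  0 < s -> 0 < u ->
  (forall theta, \int[mu]_w (expR (theta * X w))%:E <=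
     (expR (theta ^+ 2 * s / 8))%:E)%E ->
  (mu [set w | (`|X w| > u)%R] <= 2%:E * (expR (- (2 * u ^+ 2 / s)))%:E)%E.
Proof.
move=> mX s0 u0 mgf.
have mXN : measurable_fun [set: S] (fun w => - X w) by exact: measurableT_comp.
have mgfN theta : (\int[mu]_w (expR (theta * - X w))%:E <=
    (expR (theta ^+ 2 * s / 8))%:E)%E.
  by under eq_integral do rewrite mulrN -mulNr; rewrite -sqrrN.
have mL (Y : S -> R) : measurable_fun [set: S] Y -> measurable [set w | u <= Y w].
  exact: measurable_superlevel.
have mA : measurable [set w | (`|X w| > u)%R].
  rewrite (_ : [set w | _] = (Num.norm \o X) @^-1` `]u, +oo[); last first.
    by apply/seteqP; split=> w /=; rewrite in_itv/= andbT.
  by rewrite -[Z in measurable Z]setTI; exact: measurableT_comp.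
apply: (@le_trans _ _ (mu ([set w | u <= X w] `|` [set w | u <= - X w]))).
  apply: le_measure; rewrite ?inE//; first by apply: measurableU; exact: mL.
  by move=> w /=; rewrite lter_normr => /orP[] /ltW; [left|right].
apply: (le_trans (measureU2 _ (mL _ mX) (mL _ mXN))).
rewrite (_ : 2%:E = 1 + 1)%E// ge0_muleDl// mul1e.
by apply: leeD; apply: tail_one_sided.
Qed.

End tail_bound.

(** * Exponential moments of a function of the past *)

Section moment_generating_function.
Context {R : realType} {A : pointedType}.
Variables (mu : probability (paths A) R) (g : A -> pasts A -> R).
Hypothesis cA : countable [set: A].
Hypothesis g_ker : is_prob_kernel g.
Hypothesis mu_g : compatible mu g.
Hypothesis g_pos : 0 < Gamma g.
Variables (h : pasts A -> R) (K : R) (e : nat -> R) (N : nat).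
Hypothesis hK : forall z, 0 <= h z <= K.
Hypothesis e_ge0 : forall i, 0 <= e i.
Hypothesis e_supp : forall i, (N <= i)%N -> e i = 0.
Hypothesis h_osc :
  forall z z', h z <= h z' + \sum_(0 <= i < N) e i * (z i != z' i)%:R.
Variable k : int.

Let hm m := iter m (transfer g) h.

Let c := total_osc (fine \o Var g) e.

Let hmK m z : 0 <= hm m z <= K.
Proof. exact: iterate_bounds. Qed.

Let uc_hm m : unif_cont (hm m).
Proof. exact: (unif_cont_iterate cA g_ker g_pos hK h_osc). Qed.

Let pastS m : past (k - m%:Z) = past (k - m.+1%:Z + 1) :> (paths A -> pasts A).
Proof. by congr past; rewrite intS opprD addrA addrAC subrK. Qed.

Let mean_hm m :
  (\int[mu]_w (h (past k w))%:E = \int[mu]_w (hm m (past (k - m%:Z) w))%:E)%E.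
Proof.
elim: m => [|m ->]; first by rewrite subr0.
by rewrite pastS (integral_transfer cA g_ker mu_g g_pos _ (hmK m)).
Qed.

Let mean := fine (\int[mu]_w (h (past k w))%:E)%E.

Let mhm m n : measurable_fun [set: paths A] (fun w => (hm m (past n w))%:E).
Proof. by apply/measurable_EFinP; exact: measurable_unif_cont_paths. Qed.

Let int_cst (a : R) : (\int[mu]_w a%:E = a%:E)%E.
Proof. by rewrite integral_cst//= probability_setT mule1. Qed.

Lemma mean_past : (\int[mu]_w (h (past k w))%:E)%E = mean%:E.
Proof.
have h0 z : 0 <= h z by case/andP: (hK z).
rewrite fineK// ge0_fin_numE; last by apply: integral_ge0 => w _; rewrite lee_fin.
apply: (@le_lt_trans _ _ (\int[mu]_w K%:E)%E); last by rewrite int_cst ltry.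
apply: ge0_le_integral => //; last 2 first.
- exact: (@mhm 0 k).
- by move=> w _; rewrite lee_fin; case/andP: (hK (past k w)).
by move=> w _; rewrite lee_fin.
Qed.

(** Every [h_m] has the integral of [h], and for [m >= N] its values differ by at most [c m]. *)
Let hm_near_mean m z : (N <= m)%N -> `|hm m z - mean| <= c m.
Proof.
move=> Nm.
have hm0 z' : 0 <= hm m z' by case/andP: (hmK m z').
have c0 : 0 <= c m by exact: total_osc_ge0 (fine_Var_bounds g_ker) e_ge0 m.
have close z1 z2 : hm m z1 <= hm m z2 + c m.
  exact: (iterate_osc_all cA g_ker hK e_ge0 h_osc e_supp).
have mE : (\int[mu]_w (hm m (past (k - m%:Z) w))%:E = mean%:E)%E.
  by rewrite -mean_hm mean_past.
have lo : hm m z <= mean + c m.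
  rewrite -lee_fin EFinD -mE -[X in (_ + X)%E]int_cst -ge0_integralD//; last first.
    by move=> w _; rewrite lee_fin.
  rewrite -[leLHS]int_cst; apply: ge0_le_integral => //.
  - by move=> w _; rewrite lee_fin.
  - exact: emeasurable_funD.
  - by move=> w _; rewrite -EFinD lee_fin.
have hi : mean <= hm m z + c m.
  rewrite -lee_fin -mE -[leRHS]int_cst.
  by apply: ge0_le_integral => // w _; rewrite lee_fin.
by rewrite ler_norml; apply/andP; split; lra.
Qed.

(** Going back in time, the [m]-th step integrates out coordinate [k - m.+1]: [integral_transfer]
    for the exponential, then Hoeffding's lemma under the kernel, which costs [c m]. *)
Let mgf_step theta m :
  (\int[mu]_w (expR (theta * h (past k w)))%:E <=
   (expR (theta ^+ 2 / 8 * \sum_(0 <= i < m) c i ^+ 2))%:E *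
   \int[mu]_w (expR (theta * hm m (past (k - m%:Z) w)))%:E)%E.
Proof.
have mexp i n : measurable_fun [set: paths A]
    (fun w => (expR (theta * hm i (past n w)))%:E).
  apply/measurable_EFinP; apply: measurableT_comp => //.
  by apply: measurable_funM => //; apply/measurable_EFinP; exact: mhm.
elim: m => [|m IH]; first by rewrite big_nil mulr0 expR0 mul1e subr0.
apply: (le_trans IH).
rewrite big_nat_recr//= mulrDr expRD EFinM -muleA.
apply: lee_wpmul2l; first by rewrite lee_fin expR_ge0.
rewrite pastS.
have expK z : 0 <= expR (theta * hm m z) <= expR (`|theta| * K).
  rewrite expR_ge0 ler_expR (le_trans (ler_norm _))// normrM ler_wpM2l//.
  by have /andP[hm0] := hmK m z; rewrite ger0_norm.
have uce := unif_cont_expR theta (hmK m) (@uc_hm m).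
rewrite (integral_transfer cA g_ker mu_g g_pos _ expK uce).
rewrite -ge0_integralZl_EFin ?expR_ge0//; last exact: (mexp m.+1).
apply: ge0_le_integral => //.
- move=> w _; rewrite lee_fin.
  by case/andP: (transfer_bounds cA g_ker expK (past (k - m.+1%:Z) w)).
- apply/measurable_EFinP; apply: measurable_unif_cont_paths => //.
  exact: unif_cont_transfer expK uce.
- apply: measurable_funeM; exact: (mexp m.+1).
- move=> w _; rewrite -EFinM lee_fin -expRD [_ / 8 * _ + _]addrC.
  rewrite (_ : theta ^+ 2 / 8 * c m ^+ 2 = theta ^+ 2 * c m ^+ 2 / 8); last by field.

  apply: (@transfer_expR_le _ _ _ cA g_ker (hm m) theta (c m) K _ (hmK m)) => s t.
  exact: (iterate_osc_head cA g_ker hK e_ge0 h_osc).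
Qed.

Lemma mgf_past theta :
  (\int[mu]_w (expR (theta * h (past k w)))%:E <=
   (expR (theta * mean + theta ^+ 2 * Gamma g ^- 2 / 8 *
      \sum_(0 <= i < N) e i ^+ 2))%:E)%E.
Proof.
set E2 := \sum_(0 <= i < N) e i ^+ 2.
set X := theta * mean + _.
have sum_e M : \sum_(0 <= i < M) e i ^+ 2 <= E2.
  have [MN|NM] := leqP M N.
    rewrite /E2 [leRHS](big_cat_nat (n := M))//= lerDl sumr_ge0// => i _.
    exact: sqr_ge0.
  have rest0 : \sum_(N <= i < M) e i ^+ 2 = 0.
    by rewrite big_nat big1// => i /andP[Ni _]; rewrite e_supp// expr0n.
  by rewrite [leLHS](big_cat_nat (n := N) _ (ltnW NM))//= rest0 addr0.
have G2 : 0 <= Gamma g ^- 2 by rewrite invr_ge0 exprn_ge0// ltW.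
have sum_c M : \sum_(0 <= i < M) c i ^+ 2 <= Gamma g ^- 2 * E2.
  apply: (le_trans (sum_total_osc_sqr e (fine_Var_bounds g_ker) g_pos
    (Gamma_le_prod g_ker) M)).
  by rewrite ler_wpM2l.
(* A loss [d] in the exponent pays for replacing [h_M] by the mean: the sums of [c i ^+ 2] are
   bounded, so some [M >= N] has [|theta| * c M <= d]. *)
have bound d : 0 < d ->
    (\int[mu]_w (expR (theta * h (past k w)))%:E <= (expR (X + d))%:E)%E.
  move=> d0; pose d' := d / (`|theta| + 1).
  have th0 : 0 < `|theta| + 1 by rewrite ltr_wpDl.
  have d'0 : 0 < d' ^+ 2 by rewrite exprn_gt0// divr_gt0.
  have [M NM cM] := exists_small_term N (fun i => sqr_ge0 (c i)) sum_c d'0.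
  have {}cM : `|theta| * c M <= d.
    have cM' : c M <= d'.
      rewrite -ler_sqr// nnegrE; last by rewrite ltW// divr_gt0.
      exact: total_osc_ge0 (fine_Var_bounds g_ker) e_ge0 M.
    apply: (le_trans (ler_wpM2l (normr_ge0 _) cM')).
    rewrite /d' mulrCA ger_pMr// ler_pdivrMr// mul1r.
    by rewrite lerDl.
  apply: (le_trans (mgf_step theta M)).
  apply: (@le_trans _ _ ((expR (theta ^+ 2 / 8 * \sum_(0 <= i < M) c i ^+ 2))%:E *
     \int[mu]_w (expR (theta * mean + d))%:E)%E).
    apply: lee_wpmul2l; first by rewrite lee_fin expR_ge0.
    apply: ge0_le_integral => //.
    - apply/measurable_EFinP; apply: measurableT_comp => //.
      by apply: measurable_funM => //; apply/measurable_EFinP; exact: mhm.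
    - move=> w _; rewrite lee_fin ler_expR -lerBlDl -mulrBr.
      apply: (le_trans (ler_norm _)); rewrite normrM.
      by apply: le_trans cM; rewrite ler_wpM2l// hm_near_mean.
  rewrite int_cst -EFinM lee_fin -expRD ler_expR /X addrA lerD2r addrC lerD2l.
  rewrite (_ : theta ^+ 2 * Gamma g ^- 2 / 8 * E2 =
    theta ^+ 2 / 8 * (Gamma g ^- 2 * E2)); last by ring.
  by rewrite ler_wpM2l// divr_ge0 ?sqr_ge0.
have I0 : (0 <= \int[mu]_w (expR (theta * h (past k w)))%:E)%E.
  by apply: integral_ge0 => w _; rewrite lee_fin expR_ge0.
(* The bound with [d = 1] excludes an infinite integral; for [r > 0], taking logarithms lets [d]
   tend to 0. *)
case: (\int[mu]_w _)%E I0 bound => [r||]//; last by move=> _ /(_ 1 ltr01).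
rewrite !lee_fin => r0 bound.
have [->|rn0] := eqVneq r 0; first exact: expR_ge0.
have {}r0 : 0 < r by rewrite lt_neqAle eq_sym rn0.
rewrite -[r]lnK ?posrE// ler_expR; apply/ler_addgt0Pr => d d0.
by have := bound _ d0; rewrite lee_fin -{1}[r]lnK ?posrE// ler_expR.
Qed.

End moment_generating_function.

(** * Oscillations of a function of finitely many coordinates *)

Section oscillations.
Context {R : realType} {A : pointedType}.
Variables (n : nat) (f : ('I_n.+1 -> A) -> R).
Hypothesis f_osc : finite_osc f.

Let osc_ge0 j : (0 <= osc f j)%E.
Proof.
apply: ereal_sup_ubound; exists point, point, (fun=> point).
by rewrite subrr normr0.
Qed.

Lemma fine_osc_ge0 j : 0 <= fine (osc f j).
Proof. exact: fine_ge0. Qed.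

Lemma le_osc j a b (w : 'I_n.+1 -> A) :
  f [eta w with j |-> a] <= f [eta w with j |-> b] + fine (osc f j).
Proof.
rewrite -lerBlDl (le_trans (ler_norm _))// -lee_fin fineK.
  by apply: ereal_sup_ubound; exists a, b, w.
by rewrite ge0_fin_numE//; exact: f_osc.
Qed.

Let hybrid (w w' : 'I_n.+1 -> A) (k : nat) : 'I_n.+1 -> A :=
  fun i => if (i < k)%N then w' i else w i.

(** The coordinates of [w] are changed into those of [w'] one at a time along the [hybrid] points; a
    coordinate where they agree costs nothing. *)
Lemma le_sum_osc (w w' : 'I_n.+1 -> A) :
  f w <= f w' + \sum_(0 <= i < n.+1)
    fine (osc f (inord i)) * (w (inord i) != w' (inord i))%:R.
Proof.
have main k : (k <= n.+1)%N -> f w <= f (hybrid w w' k) + \sum_(0 <= i < k)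
    fine (osc f (inord i)) * (w (inord i) != w' (inord i))%:R.
  elim: k => [|k IH] kn.
    by rewrite big_nil addr0 (_ : hybrid w w' 0 = w).
  apply: (le_trans (IH (ltnW kn))); rewrite big_nat_recr//= addrCA addrC lerD2r.
  pose j : 'I_n.+1 := inord k.
  have jk : j = k :> nat by rewrite inordK.
  have Ew : hybrid w w' k = [eta hybrid w w' k with j |-> w j].
    apply/funext => i /=; case: eqVneq => [->|//].
    by rewrite /hybrid jk ltnn.
  have Ew' : hybrid w w' k.+1 = [eta hybrid w w' k with j |-> w' j].
    apply/funext => i /=; case: eqVneq => [->|ij]; first by rewrite /hybrid jk ltnSn.
    rewrite /hybrid ltnS leq_eqVlt; case: eqVneq => //= ik.
    by case/eqP: ij; apply: val_inj; rewrite /= jk.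
  rewrite -/j; have [ww'|_] := eqVneq (w j) (w' j).
    by rewrite mulr0 addr0 Ew' -ww' -Ew.
  by rewrite mulr1 Ew' {1}Ew; exact: le_osc.
have := main n.+1 (leqnn _).
by rewrite (_ : hybrid w w' n.+1 = w')//; apply/funext => i; rewrite /hybrid ltn_ord.
Qed.

End oscillations.

(* Division and exponential are taken in \bar R in the second bound: when all
   the oscillations of f vanish, x / 0 = +oo for x > 0 and expeR -oo = 0. *)
Theorem theorem3p4 (R : realType) (A : pointedType)
    (cA : countable [set: A])
    (mu : probability (paths A) R) (g : A -> pasts A -> R)
    (mu_inv : shift_invariant mu)
    (g_ker : is_prob_kernel g)
    (mu_g : compatible mu g)
    (g_pos : 0 < Gamma g)
    (n : nat) (f : ('I_n.+1 -> A) -> R) (f_osc : finite_osc f) :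
  let F := on_paths f in
  let EF := fine 'E_mu[F] in
  (forall theta : R,
     ('E_mu[fun w => expR (theta * (F w - EF))] <=
        (expR (theta ^+ 2 * Gamma g ^- 2 / 8 * osc_norm2 f))%:E)%E) /\
  (forall u : R, 0 < u ->
     (mu [set w | (`|F w - EF| > u)%R] <=
        2%:E * expeR (- ((2 * u ^+ 2)%:E /
                         (Gamma g ^- 2 * osc_norm2 f)%:E)))%E).
Proof.
move=> F EF.
(* Order is reversed: position [i] of the past of [n + 1] is coordinate [n - i]. *)
pose e i : R := if (i < n.+1)%N then fine (osc f (inord (n - i))) else 0.
pose D : R := \sum_(0 <= i < n.+1) fine (osc f (inord i)).
pose f0 := f (fun=> point).
(* The shift by [D - f0] puts the values in [[0, 2 * D]], as averages of nonnegative bounded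
   functions require; centring removes it in the end. *)
pose h (z : pasts A) : R := f (fun i : 'I_n.+1 => z (n - i)%N) - f0 + D.
have e_ge0 i : 0 <= e i by rewrite /e; case: ifP => // _; exact: fine_osc_ge0.
have e_supp i : (n.+1 <= i)%N -> e i = 0 by move=> ni; rewrite /e ltnNge ni.
have h_osc z z' : h z <= h z' + \sum_(0 <= i < n.+1) e i * (z i != z' i)%:R.
  have := le_sum_osc f_osc (fun i : 'I_n.+1 => z (n - i)%N)
    (fun i : 'I_n.+1 => z' (n - i)%N).
  rewrite big_nat_rev/= add0n.
  rewrite (eq_big_nat _ _ (F2 := fun i => e i * (z i != z' i)%:R)).
    by rewrite /h; lra.
  move=> i /andP[_ i_le_n]; rewrite ltnS in i_le_n.
  by rewrite subSS /e ltnS i_le_n inordK ?ltnS ?leq_subr// subKn.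
have f_bound w : `|f w - f0| <= D.
  have bnd w1 w2 : f w1 <= f w2 + D.
    apply: (le_trans (le_sum_osc f_osc w1 w2)); rewrite lerD2l.
    apply: ler_sum => i _; rewrite ler_piMr ?fine_osc_ge0//.
    by case: (_ != _).
  by rewrite ler_norml; have := bnd w (fun=> point); have := bnd (fun=> point) w;
    rewrite -/f0 => ? ?; apply/andP; split; lra.
have hK z : 0 <= h z <= 2 * D.
  have := f_bound (fun i : 'I_n.+1 => z (n - i)%N).
  by rewrite ler_norml /h => /andP[? ?]; apply/andP; split; lra.
have sum_e2 : \sum_(0 <= i < n.+1) e i ^+ 2 = osc_norm2 f.
  rewrite /osc_norm2 big_nat_rev/= add0n big_mkord; apply: eq_bigr => i _.
  rewrite subSS /e ltnS leq_subr subKn; last by rewrite -ltnS.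
  by rewrite inord_val.
(* With this [k], the most recent coordinate of [past k w] is [w n]. *)
pose k : int := n.+1%:Z.
have hF w : h (past k w) = F w - f0 + D.
  congr (f _ - _ + _); apply/funext => i; rewrite /past; congr w.
  by rewrite /k subzn ?ltnS ?leq_subr// subSS subKn// -ltnS.
have mh : measurable_fun [set: paths A] (fun w => h (past k w)).
  apply: measurable_unif_cont_paths => //.
  exact: unif_cont_base h_osc.
have int_h := mean_past mu cA g_ker g_pos hK h_osc k.
set m := fine _ in int_h.
have EFE : EF = m + f0 - D.
  have Fh w : F w = h (past k w) + (f0 - D) by rewrite hF; ring.
  rewrite /EF unlock; under eq_integral do rewrite Fh EFinD.
  rewrite integralD//; last 2 first.
  - apply: measurable_bounded_integrable => //.
      exact: le_lt_trans (probability_le1 mu measurableT) (ltry 1).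
    exists (2 * D); split=> [|x xD w _]; first exact: num_real.
    have /andP[h0 hD] := hK (past k w).
    by rewrite /= ger0_norm// (le_trans hD)// ltW.
  - exact: finite_measure_integrable_cst.
  by rewrite int_h integral_cst//= probability_setT mule1 -EFinD/=; ring.
have FE w : F w - EF = h (past k w) - m by rewrite hF EFE; lra.
have mgf theta : (\int[mu]_w (expR (theta * (F w - EF)))%:E <=
    (expR (theta ^+ 2 * Gamma g ^- 2 / 8 * osc_norm2 f))%:E)%E.
  have := mgf_past cA g_ker mu_g g_pos hK e_ge0 e_supp h_osc k theta.
  rewrite -/m sum_e2 => H.
  under eq_integral do rewrite FE mulrBr addrC expRD EFinM.
  rewrite ge0_integralZl_EFin ?expR_ge0//; last first.
    apply/measurable_EFinP; apply: measurableT_comp => //.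
    exact: measurable_funM.
  apply: (le_trans (lee_wpmul2l _ H)); first by rewrite lee_fin expR_ge0.
  by rewrite -EFinM lee_fin -expRD ler_expR addKr.
have mX : measurable_fun [set: paths A] (fun w => F w - EF).
  rewrite (_ : (fun w => _) = (fun w => h (past k w) - m)).
    exact: measurable_funB.
  by apply/funext => w; exact: FE.
split=> [theta|u u0]; first by rewrite unlock; exact: mgf.
have norm0 : 0 <= osc_norm2 f by apply: sumr_ge0 => j _; exact: sqr_ge0.
(* Zero norm makes [f] constant and the event empty; [subgaussian_tail] covers the positive case. *)
have [n0|nn0] := eqVneq (osc_norm2 f) 0.
  have osc0 j : fine (osc f j) = 0.
    have /eqP := n0; rewrite psumr_eq0; last by move=> i _; exact: sqr_ge0.
    by move=> /allP/(_ j (mem_index_enum _)); rewrite sqrf_eq0 => /eqP.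
  have D0 : D = 0 by rewrite /D big1.
  have Fcst w : F w = f0.
    by have := f_bound (fun i => w i%:Z); rewrite D0 normr_le0 subr_eq0 => /eqP.
  have EFcst : EF = f0.
    rewrite /EF unlock; under eq_integral do rewrite Fcst.
    by rewrite integral_cst//= probability_setT mule1.
  rewrite (_ : [set w | _] = set0) ?measure0.
    by rewrite mule_ge0// expeR_ge0.
  by apply/seteqP; split=> w //=; rewrite Fcst EFcst subrr normr0 ltNge ltW.
have s0 : 0 < Gamma g ^- 2 * osc_norm2 f.
  by rewrite mulr_gt0 ?invr_gt0 ?exprn_gt0// lt_neqAle eq_sym nn0.
have -> : expeR (- ((2 * u ^+ 2)%:E / (Gamma g ^- 2 * osc_norm2 f)%:E)) =
    (expR (- (2 * u ^+ 2 / (Gamma g ^- 2 * osc_norm2 f))))%:E.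
  by rewrite inver gt_eqF.
apply: subgaussian_tail => // theta.
rewrite (le_trans (mgf theta))// lee_fin ler_expR le_eqVlt.
by apply/orP; left; apply/eqP; ring.
Qed.
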